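(* Let $\mathbb{X}$ be a complex Banach space, let $(y(n))_{n=1}^\infty$ be a sequence in $\mathbb{X}$ converging to $0$, and let $B$ be a bounded linear operator on $\mathbb{X}$ such that $\sigma(B)\cap\Gamma$ is countable. Let $x=(x(n))_{n=1}^\infty$ be a bounded sequence in $\mathbb{X}$ satisfying $$x(n+1)=Bx(n)+y(n)\quad\text{for all } n\in\mathbb{N}.$$ If for each $\xi_0\in\sigma(B)\cap\Gamma$ $$\lim_{\lambda\downarrow\xi_0}(\lambda-\xi_0)R(\lambda,\bar S)\bar x=0,$$ then $$\lim_{n\to\infty}x(n)=0.$$
   Context: Let $\mathbb{N}=\{1,2,\dots\}$, $\Gamma=\{z\in\mathbb{C}:|z|=1\}$, and let $\sigma(B)$ be the spectrum of $B$. Let $l^\infty(\mathbb{X})$ be the Banach space of bounded sequences $(x(n))_{n\in\mathbb{N}}$ in $\mathbb{X}$ with sup-norm, and $c_0$ its closed subspace of sequences in $\mathbb{X}$ converging to $0$. The shift $S$ on $l^\infty(\mathbb{X})$ is $(Sx)(n)=x(n+1)$. Let $\mathbb{Y}=l^\infty(\mathbb{X})/c_0$ with the quotient norm; $\bar x\in\mathbb{Y}$ is the class of $x\in l^\infty(\mathbb{X})$. Since $S$ leaves $c_0$ invariant it induces an operator $\bar S$ on $\mathbb{Y}$, which is a surjective isometry, so that $\sigma(\bar S)\subset\Gamma$. For an operator $A$, $R(\lambda,A)=(\lambda-A)^{-1}$ for $\lambda$ in the resolvent set. For $0\neq z=re^{i\varphi}$ with $r=|z|$, the directional limit is $\lim_{\lambda\downarrow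 z}F(\lambda):=\lim_{s\downarrow r}F(se^{i\varphi})$ (with $s>r$). ''Countable'' includes finite or empty. *)

(* Defs.v *)
From HB Require Import structures.
From mathcomp Require Import all_boot all_order all_algebra.
From mathcomp Require Import complex.
From mathcomp Require Import all_classical all_reals all_analysis.

Set Implicit Arguments.
Unset Strict Implicit.
Unset Printing Implicit Defensive.

Import Order.TTheory GRing.Theory Num.Theory.
Import numFieldNormedType.Exports.

Local Open Scope classical_set_scope.
Local Open Scope ring_scope.
Local Open Scope complex_scope.
Local Open Scope quotient_scope.

Section Operators.
Context {K : numFieldType} {V : normedModType K}.
Implicit Types (A T : V -> V) (lambda : K).

Definition bounded_operator A :=
  linear A /\ \forall M \near +oo, forall v, `|A v| <= M * `|v|.

Definition is_resolvent A lambda T :=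
  [/\ bounded_operator T,
      forall v, T (lambda *: v - A v) = v
    & forall v, lambda *: T v - A (T v) = v].

Definition resolvent_set A : set K :=
  [set lambda | exists T, is_resolvent A lambda T].

Definition spectrum A : set K := ~` resolvent_set A.

(* The value is the zero operator when lambda is in the spectrum of A. *)
Definition resolvent lambda A : V -> V :=
  xget (fun=> 0) (is_resolvent A lambda).

Lemma is_resolvent_uniq A lambda T1 T2 :
  is_resolvent A lambda T1 -> is_resolvent A lambda T2 -> T1 = T2.
Proof.
by move=> [_ T1K _] [_ _ T2K]; apply/funext => v; rewrite -[in LHS](T2K v) T1K.
Qed.

Lemma resolventP A lambda :
  resolvent_set A lambda -> is_resolvent A lambda (resolvent lambda A).
Proof. by case=> T AT; exact: (xgetI (fun=> 0) AT). Qed.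

End Operators.

Section RealNorm.
Context {R : realType} {V : normedModType R[i]}.
Implicit Types x y : V.

(* Norms over R[i] take their values in R[i]; this is the same norm in R. *)
Definition rnorm x : R := complex.Re `|x|.

Lemma rnormE x : `|x| = (rnorm x)%:C.
Proof. by rewrite /rnorm RRe_real// normr_real. Qed.

Lemma rnorm_ge0 x : 0 <= rnorm x.
Proof. by rewrite -ler0c -rnormE normr_ge0. Qed.

Lemma Re_norm (l : R[i]) : (complex.Re `|l|)%:C = `|l|.
Proof. by rewrite RRe_real// normr_real. Qed.

Lemma Re_norm_ge0 (l : R[i]) : 0 <= complex.Re `|l|.
Proof. by rewrite -ler0c Re_norm. Qed.

Lemma rnormD x y : rnorm (x + y) <= rnorm x + rnorm y.
Proof. by rewrite -lecR rmorphD/= -!rnormE ler_normD. Qed.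

Lemma rnormZ (l : R[i]) x : rnorm (l *: x) = complex.Re `|l| * rnorm x.
Proof.
by apply: (@complexI _); rewrite rmorphM/= -!rnormE normrZ.
Qed.

Lemma rnorm0 : rnorm (0 : V) = 0.
Proof. by rewrite /rnorm normr0. Qed.

Lemma rnormN x : rnorm (- x) = rnorm x.
Proof. by rewrite /rnorm normrN. Qed.

Lemma rnorm_eq0 x : rnorm x = 0 -> x = 0.
Proof. by move=> x0; apply/normr0_eq0; rewrite rnormE x0. Qed.

Lemma bounded_funE (x : nat -> V) :
  bounded_fun x <-> exists M : R, forall n, rnorm (x n) <= M.
Proof.
split=> [/pinfty_ex_gt0[M M0 xM]|[M xM]].
  exists (complex.Re M) => n; rewrite -lecR -rnormE RRe_real ?gtr0_real//.
  exact: xM.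
apply/ex_bound; first exact: (@globally_properfilter _ _ 0%N).
by exists M%:C => n _ /=; rewrite rnormE lecR.
Qed.

Lemma cvg0_rnorm (x : nat -> V) : x @ \oo --> (0 : V) <->
  forall e : R, 0 < e -> exists N, forall n, (N <= n)%N -> rnorm (x n) < e.
Proof.
split=> [/cvgr0Pnorm_lt x0 e e0|xe].
  have [|N _ Nx] := x0 e%:C; first by rewrite ltcR.
  by exists N => n /Nx; rewrite /= rnormE ltcR.
apply/cvgr0Pnorm_lt => e e0.
have eE : e = (complex.Re e)%:C by rewrite RRe_real ?gtr0_real//.
have [|N Nx] := xe (complex.Re e); first by rewrite -ltcR -eE.
by exists N => // n /= /Nx; rewrite eE rnormE ltcR.
Qed.

End RealNorm.

Section BoundedSequences.
Context {R : realType} (X : completeNormedModType R[i]).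

Definition bounded_seq : {pred nat -> X} := fun x => `[< bounded_fun x >].

Lemma bounded_seqP (x : nat -> X) :
  reflect (exists M : R, forall n, rnorm (x n) <= M) (x \in bounded_seq).
Proof. by apply: (iffP (asboolP _)) => /bounded_funE. Qed.

Lemma bounded_seq_submod : submod_closed bounded_seq.
Proof.
split=> [|a x y /bounded_seqP[M xM] /bounded_seqP[N yN]].
  by apply/bounded_seqP; exists 0 => n; rewrite rnorm0.
apply/bounded_seqP; exists (complex.Re `|a| * M + N) => n.
rewrite (le_trans (rnormD _ _))// lerD//= rnormZ.
by rewrite ler_wpM2l ?Re_norm_ge0.
Qed.

HB.instance Definition _ :=
  GRing.isSubmodClosed.Build R[i] (nat -> X) bounded_seq bounded_seq_submod.

(* The term of index n of a sequence stands for the term of index n + 1 in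
   the convention where sequences are indexed by {1, 2, ...}. *)
Record linf := Linf { linf_val :> nat -> X ; _ : linf_val \in bounded_seq }.

HB.instance Definition _ := [isSub for linf_val].
HB.instance Definition _ := [Choice of linf by <:].
HB.instance Definition _ := [SubChoice_isSubLmodule of linf by <:].

Implicit Types x y : linf.

Lemma linf_bounded x : exists M : R, forall n, rnorm (x n) <= M.
Proof. by apply/bounded_seqP; case: x. Qed.

Definition linf_rnorm x : R := sup (range (fun n => rnorm (x n))).

Lemma linf_rnorm_ub x n : rnorm (x n) <= linf_rnorm x.
Proof.
apply: ub_le_sup; last by exists n.
by have [M xM] := linf_bounded x; exists M => _ [k _ <-].
Qed.

Lemma linf_rnorm_le x (M : R) :
  (forall n, rnorm (x n) <= M) -> linf_rnorm x <= M.
Proof.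
move=> xM; apply: ge_sup; first by exists (rnorm (x 0%N)); exists 0%N.
by move=> _ [n _ <-].
Qed.

Lemma linf_rnorm_ge0 x : 0 <= linf_rnorm x.
Proof. exact: le_trans (rnorm_ge0 _) (linf_rnorm_ub x 0). Qed.

Definition linf_norm x : R[i] := (linf_rnorm x)%:C.

Lemma linf_normD x y : linf_norm (x + y) <= linf_norm x + linf_norm y.
Proof.
rewrite /linf_norm -rmorphD lecR; apply: linf_rnorm_le => n.
by rewrite (le_trans (rnormD _ _))// lerD ?linf_rnorm_ub.
Qed.

Lemma linf_rnormZ_le (l : R[i]) x :
  linf_rnorm (l *: x) <= complex.Re `|l| * linf_rnorm x.
Proof.
apply: linf_rnorm_le => n.
by rewrite rnormZ ler_wpM2l ?Re_norm_ge0 ?linf_rnorm_ub.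
Qed.

Lemma linf_normZ (l : R[i]) x : linf_norm (l *: x) = `|l| * linf_norm x.
Proof.
apply/eqP; rewrite eq_le; apply/andP; split.
  by rewrite /linf_norm -(Re_norm l) -rmorphM lecR linf_rnormZ_le.
have [->|l0] := eqVneq l 0; first by rewrite normr0 mul0r lecR linf_rnorm_ge0.
rewrite -ler_pdivlMl ?normr_gt0// -normfV -(Re_norm l^-1) -rmorphM lecR.
by rewrite (le_trans _ (linf_rnormZ_le _ _))// scalerA mulVf// scale1r.
Qed.

Lemma linf_norm_eq0 x : linf_norm x = 0 -> x = 0.
Proof.
move=> /(@complexI _) x0; apply: val_inj; apply/funext => n /=.
by apply: rnorm_eq0; apply/eqP; rewrite eq_le rnorm_ge0 andbT -x0 linf_rnorm_ub.
Qed.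

HB.instance Definition _ :=
  @Lmodule_isNormed.Build R[i] linf linf_norm linf_normD linf_normZ
    linf_norm_eq0.

Definition c0 : {pred linf} :=
  fun x => `[< (x : nat -> X) @ \oo --> (0 : X) >].

Lemma c0P x : reflect
  (forall e : R, 0 < e -> exists N, forall n, (N <= n)%N -> rnorm (x n) < e)
  (x \in c0).
Proof. by apply: (iffP (asboolP _)) => /cvg0_rnorm. Qed.

Lemma c0_submod : submod_closed c0.
Proof.
split=> [|a x y /asboolP x0 /asboolP y0]; apply/asboolP; first exact: cvg_cst.
rewrite -[X in _ --> X]addr0 -[X in _ --> X + _](scaler0 _ a).
by apply: cvgD => //; apply: cvgZl_tmp.
Qed.

HB.instance Definition _ :=
  GRing.isSubmodClosed.Build R[i] linf c0 c0_submod.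

Definition linf_quot := Quotient.quot c0.

HB.instance Definition _ := GRing.Zmodule.on linf_quot.
HB.instance Definition _ := EqQuotient.on linf_quot.

Definition c0_class (x : linf) : linf_quot := \pi_(linf_quot) x.

Implicit Types u v : linf_quot.

Lemma classP x y : c0_class x = c0_class y <-> x - y \in c0.
Proof.
rewrite (Quotient.idealrBE c0); split=> [xy|/eqP//].
by apply/eqP.
Qed.

Lemma class_repr u : c0_class (repr u) = u.
Proof. exact: reprK. Qed.

Lemma classB : {morph c0_class : x y / x - y}.
Proof. exact: (raddfB (\pi_(Quotient.quot c0))). Qed.

Lemma classD : {morph c0_class : x y / x + y}.
Proof. exact: (raddfD (\pi_(Quotient.quot c0))). Qed.

Lemma class0 : c0_class 0 = 0.
Proof. exact: (raddf0 (\pi_(Quotient.quot c0))). Qed.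

Lemma repr_class x : repr (c0_class x) - x \in c0.
Proof. by apply/classP; rewrite class_repr. Qed.

Definition quot_scale (l : R[i]) u : linf_quot := c0_class (l *: repr u).

Lemma quot_scaleE (l : R[i]) x : quot_scale l (c0_class x) = c0_class (l *: x).
Proof. by apply/classP; rewrite -scalerBr rpredZ// repr_class. Qed.

Lemma quot_scalerA (a b : R[i]) u :
  quot_scale a (quot_scale b u) = quot_scale (a * b) u.
Proof. by rewrite -(class_repr u) !quot_scaleE scalerA. Qed.

Lemma quot_scale1r : left_id 1 quot_scale.
Proof. by move=> u; rewrite -(class_repr u) quot_scaleE scale1r. Qed.

Lemma quot_scalerDr : right_distributive quot_scale +%R.
Proof.
move=> a u v; rewrite -(class_repr u) -(class_repr v) -classD !quot_scaleE.
by rewrite scalerDr classD.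
Qed.

Lemma quot_scalerDl u : {morph quot_scale^~ u : a b / a + b}.
Proof.
by move=> a b; rewrite -(class_repr u) !quot_scaleE scalerDl classD.
Qed.

HB.instance Definition _ := GRing.Zmodule_isLmodule.Build R[i] linf_quot
  quot_scalerA quot_scale1r quot_scalerDr quot_scalerDl.

Lemma classZ (l : R[i]) x : c0_class (l *: x) = l *: c0_class x.
Proof. by rewrite -quot_scaleE. Qed.

Definition quot_rnorm u : R := inf [set rnorm x | x in [set x | c0_class x = u]].

Lemma quot_rnorm_le x : quot_rnorm (c0_class x) <= rnorm x.
Proof.
apply: ge_inf; last by exists x.
by exists 0 => _ [y _ <-]; exact: rnorm_ge0.
Qed.

Lemma le_quot_rnorm u (m : R) :
  (forall x, c0_class x = u -> m <= rnorm x) -> m <= quot_rnorm u.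
Proof.
move=> um; apply: lb_le_inf; last by move=> _ [x xu <-]; exact: um.
by exists (rnorm (repr u)); exists (repr u) => //; exact: class_repr.
Qed.

Lemma quot_rnorm_ge0 u : 0 <= quot_rnorm u.
Proof. by apply: le_quot_rnorm => x _; exact: rnorm_ge0. Qed.

Lemma quot_rnorm_adherent u (e : R) :
  0 < e -> exists2 x, c0_class x = u & rnorm x < quot_rnorm u + e.
Proof.
move=> e0; apply: contrapT => nex.
suff : quot_rnorm u + e <= quot_rnorm u by rewrite gerDl leNgt e0.
apply: le_quot_rnorm => x xu; rewrite leNgt; apply/negP => xe.
by apply: nex; exists x.
Qed.

Definition quot_norm u : R[i] := (quot_rnorm u)%:C.

Lemma quot_normD u v : quot_norm (u + v) <= quot_norm u + quot_norm v.
Proof.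
rewrite /quot_norm -rmorphD lecR; apply/ler_addgt0Pr => e e0.
have e20 : 0 < e / 2 by rewrite divr_gt0.
have [x xu xe] := quot_rnorm_adherent u e20.
have [y yv ye] := quot_rnorm_adherent v e20.
rewrite -{1}xu -{1}yv -classD (le_trans (quot_rnorm_le _))//.
rewrite (le_trans (rnormD _ _))// [e]splitr addrACA.
by rewrite lerD// ltW.
Qed.

Lemma quot_rnormZ_le (l : R[i]) u :
  quot_rnorm (l *: u) <= complex.Re `|l| * quot_rnorm u.
Proof.
have [->|l0] := eqVneq l 0.
  rewrite scale0r normr0 mul0r -class0.
  by rewrite (le_trans (quot_rnorm_le _))// rnorm0.
have Rl0 : 0 < complex.Re `|l| by rewrite -ltcR Re_norm normr_gt0.
rewrite -ler_pdivrMl//; apply: le_quot_rnorm => x <-.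
by rewrite ler_pdivrMl// -rnormZ -classZ quot_rnorm_le.
Qed.

Lemma quot_normZ (l : R[i]) u : quot_norm (l *: u) = `|l| * quot_norm u.
Proof.
apply/eqP; rewrite eq_le; apply/andP; split.
  by rewrite /quot_norm -(Re_norm l) -rmorphM lecR quot_rnormZ_le.
have [->|l0] := eqVneq l 0; first by rewrite normr0 mul0r lecR quot_rnorm_ge0.
rewrite -ler_pdivlMl ?normr_gt0// -normfV -(Re_norm l^-1) -rmorphM lecR.
by rewrite (le_trans _ (quot_rnormZ_le _ _))// scalerA mulVf// scale1r.
Qed.

Lemma quot_norm_eq0 u : quot_norm u = 0 -> u = 0.
Proof.
move=> /(@complexI _) u0; rewrite -(class_repr u) -class0.
apply/classP; rewrite subr0; apply/c0P => e e0.
have e20 : 0 < e / 2 by rewrite divr_gt0.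
have [x xu xe] := quot_rnorm_adherent u e20; rewrite u0 add0r in xe.
have /c0P/(_ _ e20)[N xN] : repr u - x \in c0.
  by apply/classP; rewrite class_repr.
exists N => n /xN uxn.
rewrite -[repr u n](subrK (x n)) (le_lt_trans (rnormD _ _))// [e]splitr.
by rewrite ltrD// (le_lt_trans (linf_rnorm_ub _ _)).
Qed.

HB.instance Definition _ :=
  @Lmodule_isNormed.Build R[i] linf_quot quot_norm quot_normD quot_normZ
    quot_norm_eq0.

Lemma linf_shift_bounded x : (fun n => x n.+1) \in bounded_seq.
Proof.
by have [M xM] := linf_bounded x; apply/bounded_seqP; exists M => n.
Qed.

Definition linf_shift x : linf := Linf (linf_shift_bounded x).

Lemma shift_c0 x : x \in c0 -> linf_shift x \in c0.
Proof.
move=> /c0P x0; apply/c0P => e /x0[N xN]; exists N => n Nn.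
by apply: xN; rewrite (leq_trans Nn).
Qed.

Definition quot_shift u : linf_quot := c0_class (linf_shift (repr u)).

Lemma quot_shiftE x : quot_shift (c0_class x) = c0_class (linf_shift x).
Proof.
apply/classP; rewrite (_ : _ - _ = linf_shift (repr (c0_class x) - x)).
  by apply: shift_c0; exact: repr_class.
exact: val_inj.
Qed.

End BoundedSequences.

Arguments c0_class {R X} x.
Arguments linf_shift {R X} x.
Arguments quot_shift {R X} u.

Section DirectionalLimit.
Context {R : realType}.

Definition unit_circle : set R[i] := [set z | `|z| = 1].

(* lambda = s * exp(i phi) with s decreasing to r, where z = r * exp(i phi) *)
Definition downto (z : R[i]) : set_system R[i] :=
  (s%:C * (z / `|z|)) @[s --> (complex.Re `|z|)^'+].

Global Instance downto_filter (z : R[i]) : ProperFilter (downto z).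
Proof. exact: fmap_proper_filter. Qed.

End DirectionalLimit.

(* Main.v *)
From HB Require Import structures.
Require Import Defs.
From mathcomp Require Import all_boot all_order all_algebra.
From mathcomp Require Import complex ring lra zify.
From mathcomp Require Import all_classical all_reals all_analysis.

Set Implicit Arguments.
Unset Strict Implicit.
Unset Printing Implicit Defensive.

Import Order.TTheory GRing.Theory Num.Theory.
Import numFieldNormedType.Exports.

Local Open Scope classical_set_scope.
Local Open Scope ring_scope.
Local Open Scope complex_scope.

(** In Y = l^oo / c_0 the class u of x satisfies S u = B u, so R(z, B) u solves
    (z - S) w = u near every point z of the circle outside the spectrum of B,
    while at the points e_0, e_1, ... of the spectrum the limit hypothesis puts
    u in the closure of the range of S - e_j.

    For u in that closure there are trigonometric polynomials p_j, equal to 1 up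
    to an exponentially small error on a fixed neighbourhood of e_j, of bounded
    Wiener norm and with p_j(S) u as small as desired: trapezoids of width 1/L
    convolved with the kernel |1 + z|^(2m), so that (z - e_j) p_j has Wiener norm
    O(1/L). Requiring |p_j(S) u| <= eps / 6^j and multiplying by a power of z to
    have nonnegative exponents only, u is within eps of h(S) u, up to the isometry
    S^N, where h = prod_j (1 - p_j) over the finitely many j left by compactness of
    the circle. Finally h(S) u is an average over roots of unity of h(z) times
    smoothed spectral densities of u at z; as m grows these tend to 0 away from
    the spectrum and grow at most linearly in m near it, where h is exponentially
    small. Hence u = 0. Countability of the spectrum is what allows the summable
    choice of errors. *)

(** * Real-valued modulus of complex numbers *)

Section Modulus.
Context {R : realType}.
Implicit Types z w : R[i].

Definition cabs z : R := complex.Re `|z|.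

Lemma cabsE z : `|z| = (cabs z)%:C.
Proof. by rewrite Re_norm. Qed.

Lemma cabs_ge0 z : 0 <= cabs z.
Proof. exact: Re_norm_ge0. Qed.

Lemma cabsM z w : cabs (z * w) = cabs z * cabs w.
Proof. by apply: (@complexI R); rewrite rmorphM/= -!cabsE normrM. Qed.

Lemma cabsD z w : cabs (z + w) <= cabs z + cabs w.
Proof. by rewrite -lecR rmorphD/= -!cabsE ler_normD. Qed.

Lemma cabsN z : cabs (- z) = cabs z.
Proof. by rewrite /cabs normrN. Qed.

Lemma cabsC z w : cabs (z - w) = cabs (w - z).
Proof. by rewrite /cabs distrC. Qed.

Lemma cabsB z w : cabs (z - w) <= cabs z + cabs w.
Proof. by rewrite (le_trans (cabsD _ _))// cabsN. Qed.

Lemma cabs0 : cabs 0 = 0.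
Proof. by rewrite /cabs normr0. Qed.

Lemma cabs1 : cabs 1 = 1.
Proof. by rewrite /cabs normr1. Qed.

Lemma cabs_eq0 z : (cabs z == 0) = (z == 0).
Proof.
apply/eqP/eqP => [z0|->]; last exact: cabs0.
by apply/normr0_eq0; rewrite cabsE z0.
Qed.

Lemma cabsX z n : cabs (z ^+ n) = cabs z ^+ n.
Proof. by elim: n => [|n IH]; rewrite ?cabs1// !exprS cabsM IH. Qed.

Lemma cabsV z : cabs z^-1 = (cabs z)^-1.
Proof.
by apply: (@complexI R); rewrite fmorphV/= -!cabsE normfV.
Qed.

Lemma cabsR (r : R) : cabs r%:C = `|r|.
Proof.
apply: (@complexI R); rewrite -cabsE normc_def /= expr0n /= addr0.
by rewrite sqrtr_sqr.
Qed.

Lemma cabs_nat n : cabs n%:R = n%:R.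
Proof. by rewrite -(rmorph_nat (real_complex R)) cabsR normr_nat. Qed.

Lemma cabs_sum (I : Type) (r : seq I) (P : pred I) (F : I -> R[i]) :
  cabs (\sum_(i <- r | P i) F i) <= \sum_(i <- r | P i) cabs (F i).
Proof.
elim/big_rec2: _ => [|i y1 y2 _ IH]; first by rewrite cabs0.
by rewrite (le_trans (cabsD _ _))// lerD2l.
Qed.

Lemma cabs_sqr z : cabs z ^+ 2 = complex.Re z ^+ 2 + complex.Im z ^+ 2.
Proof. by apply: (@complexI R); rewrite rmorphXn/= -cabsE -add_Re2_Im2. Qed.

Lemma cabs_conj z : (cabs z ^+ 2)%:C = z * z^*%C.
Proof. by rewrite rmorphXn/= -cabsE sqr_normc. Qed.

Lemma unit_circleE z : unit_circle z <-> cabs z = 1.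
Proof.
by rewrite /unit_circle/= cabsE; split=> [/(@complexI R)//|->].
Qed.

Lemma cabs1_neq0 z : cabs z = 1 -> z != 0.
Proof. by move=> z1; rewrite -cabs_eq0 z1 oner_neq0. Qed.

Lemma cabs1_conj z : cabs z = 1 -> z^*%C = z^-1.
Proof.
move=> z1; have := cabs_conj z; rewrite z1 expr1n => /esym zz.
apply: (mulfI (cabs1_neq0 z1)).
by rewrite zz mulfV// cabs1_neq0.
Qed.

End Modulus.

(** * Parametrisation of the unit circle by angles *)

Section UnitCircle.
Context {R : realType}.
Implicit Types t s : R.

Definition expi t : R[i] := (cos t +i* sin t)%C.

Lemma expiD t s : expi (t + s) = expi t * expi s.
Proof.
apply/eqP; rewrite eq_complex /= cosD sinD.
by apply/andP; split; apply/eqP; ring.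
Qed.

Lemma expi0 : expi 0 = 1.
Proof. by rewrite /expi cos0 sin0. Qed.

Lemma expiX t n : expi t ^+ n = expi (t * n%:R).
Proof.
elim: n => [|n IH]; first by rewrite mulr0 expi0.
by rewrite exprS IH -expiD -natr1 mulrDr mulr1 addrC.
Qed.

Lemma expi2pi : expi (pi *+ 2) = 1.
Proof. by rewrite /expi cos2pi sin2pi. Qed.

Lemma cabs_expi t : cabs (expi t) = 1.
Proof.
apply/eqP; rewrite -(@eqrXn2 _ 2) ?cabs_ge0// expr1n.
by rewrite cabs_sqr /= cos2Dsin2.
Qed.

Lemma cabs_expiB1 t : cabs (expi t - 1) ^+ 2 = 2 - 2 * cos t.
Proof.
rewrite cabs_sqr /= oppr0 addr0.
have := cos2Dsin2 t; set c := cos t; set s := sin t => cs.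
rewrite [LHS](_ : _ = (c ^+ 2 + s ^+ 2) - 2 * c + 1); last by ring.
by rewrite cs; ring.
Qed.

Lemma cos_lipschitz t s : `|cos t - cos s| <= `|t - s|.
Proof.
wlog ts : t s / t < s.
  move=> H; have [/H//|/H|->] := ltgtP t s; last by rewrite !subrr.
  by rewrite distrC (distrC s).
have [c _ E] := @MVT R cos (fun x => - sin x) t s ts
  (fun x _ => is_derive_cos x) (continuous_subspaceT (@continuous_cos R)).
by rewrite distrC E normrM normrN distrC ler_piMl// sin_max.
Qed.

Lemma sin_lipschitz t s : `|sin t - sin s| <= `|t - s|.
Proof.
wlog ts : t s / t < s.
  move=> H; have [/H//|/H|->] := ltgtP t s; last by rewrite !subrr.
  by rewrite distrC (distrC s).
have [c _ E] := @MVT R sin cos t s ts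
  (fun x _ => is_derive_sin x) (continuous_subspaceT (@continuous_sin R)).
by rewrite distrC E normrM distrC ler_piMl// cos_max.
Qed.

Lemma expi_lipschitz t s : cabs (expi t - expi s) <= 2 * `|t - s|.
Proof.
have {1}-> : expi t - expi s =
    (cos t - cos s)%:C + 'i%C * (sin t - sin s)%:C.
  by rewrite [LHS]complexE.
rewrite (le_trans (cabsD _ _))// cabsM !cabsR.
have -> : cabs ('i%C : R[i]) = 1.
  have := cabs_expi (pi / 2); rewrite /expi cos_pihalf sin_pihalf.
  by [].
by rewrite mul1r mulr2n mulrDl !mul1r lerD ?cos_lipschitz ?sin_lipschitz.
Qed.

(** Cosine decreases on [[0, pi]]; beyond [pi], the reflection [2 pi - t] brings the angle back
    there. *)
Lemma cos_le_away a t : 0 <= a <= pi -> a <= t <= pi *+ 2 - a -> cos t <= cos a.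
Proof.
move=> /andP[a0 api] /andP[at_ ta].
have [tpi|pit] := leP t pi.
  rewrite leNgt ltr_cos ?in_itv/= ?a0 ?api// ?tpi ?(le_trans a0)//.
  by rewrite -leNgt.
rewrite -[cos t]cosN -(cosD2pi (- t)).
rewrite leNgt ltr_cos ?in_itv/= ?a0 ?api//; last by apply/andP; split; lra.
by rewrite -leNgt; lra.
Qed.

Lemma cos_lt1 t : 0 < t < pi *+ 2 -> cos t < 1.
Proof.
move=> /andP[t0 t2].
(* The angular distance from [t] to the multiples of [2 pi]. *)
pose a := Num.min t (pi *+ 2 - t).
have a0 : 0 < a by rewrite lt_min t0 subr_gt0.
have [at_ ta] : a <= t /\ a <= pi *+ 2 - t by split; rewrite ge_min lexx ?orbT.
have api : a <= pi by lra.
apply: (@le_lt_trans _ _ (cos a)).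
  by apply: cos_le_away; apply/andP; split; lra.
rewrite -cos0 ltr_cos// in_itv/= ?lexx ?pi_ge0// ltW//.
Qed.

End UnitCircle.

(** * Orthogonality and Parseval over the [M]-th roots of unity *)

Section RootsOfUnity.
Context {R : realType}.
Variable M : nat.
Hypothesis M_gt0 : (0 < M)%N.

Definition zeta : R[i] := expi (pi *+ 2 / M%:R).

Lemma zetaX k : zeta ^+ k = expi (pi *+ 2 * k%:R / M%:R).
Proof. by rewrite expiX mulrAC. Qed.

Lemma zetaM : zeta ^+ M = 1.
Proof. by rewrite zetaX mulfK ?expi2pi// pnatr_eq0 -lt0n. Qed.

Lemma cabs_zetaX k : cabs (zeta ^+ k) = 1.
Proof. by rewrite zetaX cabs_expi. Qed.

Lemma zetaX_neq0 k : zeta ^+ k != 0.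
Proof. exact/cabs1_neq0/cabs_zetaX. Qed.

Lemma zetaX_neq1 k : (0 < k < M)%N -> zeta ^+ k != 1.
Proof.
move=> /andP[k0 kM]; rewrite -subr_eq0 -cabs_eq0 -(@eqrXn2 _ 2) ?cabs_ge0//.
rewrite expr0n/= zetaX cabs_expiB1 gt_eqF// subr_gt0 gtr_pMr//.
have Mp : 0 < M%:R :> R by rewrite ltr0n.
have pip : 0 < pi *+ 2 :> R by rewrite pmulrn_lgt0// pi_gt0.
apply: cos_lt1; rewrite divr_gt0//= ?mulr_gt0// ?ltr0n//.
by rewrite ltr_pdivrMr// ltr_pM2l// ltr_nat.
Qed.

Lemma zeta_orth a b : (a < M)%N -> (b < M)%N ->
  \sum_(k < M) zeta ^+ (k * a) / zeta ^+ (k * b) = M%:R *+ (a == b) :> R[i].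
Proof.
move=> aM bM.
under eq_bigr => k _ do
  rewrite mulnC exprM (mulnC k) (exprM _ b) -exprVn -exprMn.
have [<-|ab] := eqVneq a b.
  under eq_bigr => k _ do rewrite mulfV ?zetaX_neq0// expr1n.
  by rewrite sumr_const card_ord.
set x := zeta ^+ a / _.
have xM : x ^+ M = 1.
  by rewrite /x exprMn exprVn -!exprM !(mulnC _ M) !exprM zetaM !expr1n invr1 mulr1.
have x1 : x != 1.
  rewrite /x -subr_eq0 -[1](mulfV (zetaX_neq0 b)) -mulrBl mulf_eq0.
  rewrite invr_eq0 (negbTE (zetaX_neq0 _)) orbF subr_eq0.
  wlog ltab : a b aM bM ab {x xM} / (a < b)%N.
    move=> H; have [ltab|ltba|abE] := ltngtP a b; first exact: H.
      by rewrite eq_sym; apply: H => //; rewrite eq_sym.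
    by rewrite abE eqxx in ab.
  rewrite -(subnKC (ltnW ltab)) exprD -[X in X == _]mulr1.
  rewrite (inj_eq (mulfI (zetaX_neq0 _))) eq_sym zetaX_neq1//.
  by rewrite subn_gt0 ltab (leq_ltn_trans (leq_subr _ _)).
(* The geometric sum of a root of unity [x] other than 1, multiplied by [x - 1], is
   [x ^+ M - 1 = 0]. *)
apply/(mulfI (_ : x - 1 != 0)); first by rewrite subr_eq0.
by rewrite -subrX1 xM subrr mulr0.
Qed.

(** Expanding the square leaves only the diagonal: as [N <= M], the frequencies are distinct modulo
    [M]. *)
Lemma parseval (f : nat -> R[i]) (N : nat) : (N <= M)%N ->
  \sum_(n < M) cabs (\sum_(k < N) f k * zeta ^+ (n * k)) ^+ 2
  = M%:R * \sum_(k < N) cabs (f k) ^+ 2.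
Proof.
move=> NM; apply: (@complexI R).
rewrite rmorph_sum rmorphM/= rmorph_nat rmorph_sum/=.
transitivity (\sum_(n < M) \sum_(k < N) \sum_(l < N)
   (f k * (f l)^*%C) * (zeta ^+ (n * k) / zeta ^+ (n * l)) : R[i]).
  apply: eq_bigr => n _; rewrite cabs_conj rmorph_sum/= mulr_suml.
  apply: eq_bigr => k _; rewrite mulr_sumr; apply: eq_bigr => l _.
  by rewrite rmorphM/= (cabs1_conj (cabs_zetaX _)); ring.
rewrite exchange_big mulr_sumr; apply: eq_bigr => k _ /=.
rewrite exchange_big /= (bigD1 k)//= -mulr_sumr.
rewrite zeta_orth ?eqxx ?(leq_trans (ltn_ord _))// mulr1n.
rewrite [X in _ + X](_ : _ = 0) ?addr0 ?cabs_conj 1?mulrC//.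
apply: big1 => l lk; rewrite -mulr_sumr zeta_orth ?(leq_trans (ltn_ord _))//.
by rewrite eq_sym (negbTE (lk : (l : nat) != k)) mulr0n mulr0.
Qed.

End RootsOfUnity.

(** * Central binomial coefficients *)

Section Binomials.
Local Open Scope nat_scope.
Variable m : nat.

Lemma bin_central_incr i : i < m -> 'C(m.*2, i) <= 'C(m.*2, i.+1).
Proof.
move=> im; rewrite -(@leq_pmul2l i.+1)// mul_bin_left leq_mul2r.
by apply/orP; right; lia.
Qed.

Lemma bin_central_decr i : m <= i -> 'C(m.*2, i.+1) <= 'C(m.*2, i).
Proof.
move=> mi; rewrite -(@leq_pmul2l i.+1)// mul_bin_left leq_mul2r.
by apply/orP; right; lia.
Qed.

Lemma bin_central_max i : 'C(m.*2, i) <= 'C(m.*2, m).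
Proof.
have [im|mi] := leqP i m.
  rewrite -(subKn im); elim: (m - i) => [|k IH]; first by rewrite subn0.
  have [mk|km] := leqP m k.
    by rewrite (_ : m - k.+1 = m - k) //; lia.
  apply: leq_trans IH; rewrite (_ : m - k = (m - k.+1).+1); last by lia.
  by apply: bin_central_incr; lia.
rewrite -(subnKC (ltnW mi)); elim: (i - m) => [|k IH]; first by rewrite addn0.
apply: leq_trans IH; rewrite addnS; apply: bin_central_decr; exact: leq_addr.
Qed.

(** Each of the [2m + 1] terms of [(1 + 1)^(2m)] is at most the central one. *)
Lemma bin_central_ge : 4 ^ m <= m.*2.+1 * 'C(m.*2, m).
Proof.
rewrite (_ : 4 = 2 ^ 2)// -expnM mul2n -[2]/(1 + 1) expnDn.
rewrite (leq_trans (n := \sum_(i < m.*2.+1) 'C(m.*2, m)))//.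
  by apply: leq_sum => i _; rewrite !exp1n !muln1 bin_central_max.
by rewrite sum_nat_const card_ord.
Qed.

End Binomials.

Section BinomialVariation.
Context {R : realType}.
Variable m : nat.

Definition bin_prev i : R := if i is j.+1 then 'C(m.*2, j)%:R else 0.

(** The row rises from 0 to its central value and then falls back, so each half telescopes to at
    most that value. *)
Lemma bin_variation :
  \sum_(i < m.*2.+2) `|bin_prev i - 'C(m.*2, i)%:R| <= 2 * 'C(m.*2, m)%:R.
Proof.
have -> : m.*2.+2 = (m.+1 + m.+1)%N by lia.
rewrite -(big_mkord xpredT (fun i => `|bin_prev i - 'C(m.*2, i)%:R|)).
rewrite (big_cat_nat (n := m.+1))//= ?leq_addr// mulr2n mulrDl mul1r lerD//.
  rewrite [leLHS](_ : _ = \sum_(0 <= i < m.+1) (bin_prev i.+1 - bin_prev i)).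
    by rewrite telescope_sumr// subr0.
  apply: eq_big_nat => i /andP[_ im].
  rewrite distrC ger0_norm// subr_ge0; case: i im => [|i] im //=.
  by rewrite ler_nat bin_central_incr.
rewrite [leLHS](_ : _ = \sum_(m.+1 <= i < m.+1 + m.+1)
                           (- bin_prev i.+1 - - bin_prev i)).
  by rewrite telescope_sumr ?leq_addr//= opprK gerDr oppr_le0.
apply: eq_big_nat => i /andP[im _].
rewrite ger0_norm; first by rewrite opprK addrC.
by rewrite subr_ge0; case: i im => [|i] im //=; rewrite ler_nat bin_central_decr.
Qed.

End BinomialVariation.

(** * The Wiener norm of a polynomial *)

Section CoefNorm.
Context {R : realType}.
Implicit Types p : {poly R[i]}.

Definition anorm p : R := \sum_(i < size p) cabs p`_i.

Lemma anormE p N : (size p <= N)%N -> anorm p = \sum_(i < N) cabs p`_i.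
Proof.
move=> pN; rewrite /anorm (big_ord_widen _ (fun i => cabs p`_i) pN).
rewrite big_mkcond /=; apply: eq_bigr => i _.
by case: ltnP => // pi; rewrite nth_default// cabs0.
Qed.

Lemma cabs_horner p z : cabs z = 1 -> cabs p.[z] <= anorm p.
Proof.
move=> z1; rewrite horner_coef (le_trans (cabs_sum _ _ _))// ler_sum// => i _.
by rewrite cabsM cabsX z1 expr1n mulr1.
Qed.

(** Cauchy-Schwarz in additive form, from [0 <= (s u - v)^2]; the weight [s] balances factors of
    different sizes. *)
Lemma sum_mul_le (N : nat) (u v : nat -> R) s : 0 < s ->
  \sum_(n < N) u n * v n <=
  (s * (\sum_(n < N) u n ^+ 2) + s^-1 * (\sum_(n < N) v n ^+ 2)) / 2.
Proof.
move=> s0; rewrite !mulr_sumr -big_split/= mulr_suml ler_sum// => i _.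
rewrite ler_pdivlMr// -subr_ge0.
rewrite (_ : _ - _ = s^-1 * (s * u i - v i) ^+ 2).
  by rewrite mulr_ge0 ?sqr_ge0// invr_ge0 ltW.
by field; rewrite gt_eqF.
Qed.

Lemma ler_sum_ord (F : nat -> R) N N' : (N <= N')%N -> (forall n, 0 <= F n) ->
  \sum_(n < N) F n <= \sum_(n < N') F n.
Proof.
move=> NN' F0; rewrite -!(big_mkord xpredT F) [leRHS](big_cat_nat (n := N))//=.
by rewrite lerDl sumr_ge0.
Qed.

End CoefNorm.

(** The arc is centred at index [2a]; once [l] reaches [3a], the index [k + l] is at distance at
    least [a] from that centre modulo [M]. *)
Lemma far_index a M k l : (k < a)%N -> (3 * a <= l < M)%N ->
  (a <= k + l - a.*2 <= M - a)%N /\ (k + l = a.*2 + (k + l - a.*2))%N.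
Proof. by lia. Qed.

(** * Bump polynomials near a point of the circle *)

Section Bump.
Context {R : realType}.
Variables (L m : nat) (xi : R[i]).
Hypothesis L3 : (3 <= L)%N.
Hypothesis xi1 : cabs xi = 1.

Let a := m.+1.
Let M := (a * L)%N.
Let z : R[i] := zeta M.
(** The phase that centres the arc: [b * z ^+ (k + l) * xi = 1] when [k + l = 2a]. *)
Let b : R[i] := (z ^+ (a.*2))^-1 / xi.

Let m2 : (m <= m.*2)%N. Proof. by rewrite -addnn leq_addr. Qed.
Let M_gt0 : (0 < M)%N. Proof. by rewrite /M /a; nia. Qed.
Let aM3 : (3 * a <= M)%N. Proof. by rewrite /M mulnC leq_mul2l L3 orbT. Qed.
Let aM : (a <= M)%N. Proof. by rewrite (leq_trans _ aM3)// leq_pmull. Qed.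
Let mM : (m.*2.+2 <= M)%N. Proof. by rewrite (leq_trans _ aM3)// /a; lia. Qed.
Let L_gt0 : 0 < L%:R :> R. Proof. by rewrite ltr0n; lia. Qed.
Let a_gt0 : 0 < a%:R :> R. Proof. by rewrite ltr0n. Qed.
Let MR : M%:R = a%:R * L%:R :> R. Proof. by rewrite /M natrM. Qed.
Let zX1 k : cabs (z ^+ k) = 1. Proof. exact: cabs_zetaX. Qed.
Let z_neq0 k : z ^+ k != 0. Proof. exact: zetaX_neq0. Qed.
Let b1 : cabs b = 1.
Proof. by rewrite /b cabsM !cabsV zX1 xi1 invr1 mulr1. Qed.
Let bX1 k : cabs (b ^+ k) = 1. Proof. by rewrite cabsX b1 expr1n. Qed.
Let b_neq0 k : b ^+ k != 0. Proof. exact/cabs1_neq0/bX1. Qed.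

(* The average of (b z^(k+l))^(n-m) over 0 <= k < a and 0 <= l < 3a, times
   3a / M; these are the Fourier coefficients of a trapezoid around xi. *)
Definition arc_sum N n : R[i] := \sum_(k < N) (z ^+ (k * m))^-1 * z ^+ (n * k).

Definition trapezoid_coef n : R[i] :=
  b ^+ n / b ^+ m * (arc_sum a n * arc_sum (3 * a) n) / (a * M)%:R.

(** Up to normalisation by the central coefficient, the weights are the Fourier coefficients of
    [|1 + z|^(2m)]. Index [n] stands for frequency [n - m], so that all exponents are
    nonnegative. *)
Definition bump_poly : {poly R[i]} := \poly_(n < m.*2.+1)
  (('C(m.*2, n)%:R / 'C(m.*2, m)%:R) * trapezoid_coef n).

Lemma size_bump : (size bump_poly <= m.*2.+1)%N.
Proof. exact: size_poly. Qed.

Lemma arc_sum_parseval N : (N <= M)%N ->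
  \sum_(n < M) cabs (arc_sum N n) ^+ 2 = M%:R * N%:R.
Proof.
move=> NM; rewrite (parseval M_gt0 (fun k => (z ^+ (k * m))^-1))//.
under eq_bigr => k _ do rewrite cabsV zX1 invr1 expr1n.
by rewrite sumr_const card_ord.
Qed.

Let bincR_gt0 : 0 < 'C(m.*2, m)%:R :> R.
Proof. by rewrite ltr0n bin_gt0. Qed.

Let binc_ratio n : cabs ('C(m.*2, n)%:R / 'C(m.*2, m)%:R : R[i]) =
  'C(m.*2, n)%:R / 'C(m.*2, m)%:R.
Proof. by rewrite cabsM cabsV !cabs_nat. Qed.

Let binc_ratio_le1 n : 'C(m.*2, n)%:R / 'C(m.*2, m)%:R <= 1 :> R.
Proof. by rewrite ler_pdivrMr// mul1r ler_nat bin_central_max. Qed.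

Let mMle : (m.*2.+1 <= M)%N. Proof. exact: ltnW. Qed.

Lemma cabs_trapezoid n :
  cabs (trapezoid_coef n) =
  cabs (arc_sum a n) * cabs (arc_sum (3 * a) n) / (a * M)%:R.
Proof.
rewrite /trapezoid_coef 2!cabsM cabsV cabs_nat cabsM cabsV !bX1 invr1 !mul1r.
by rewrite cabsM.
Qed.

Let aMR_gt0 : 0 < (a * M)%:R :> R.
Proof. by rewrite ltr0n muln_gt0 M_gt0. Qed.

(** The weights are at most 1 and each trapezoid coefficient is a product of two arc sums, so
    Parseval on both arcs gives [(a + 3a) / (2a) = 2]. *)
Lemma anorm_bump : anorm bump_poly <= 2.
Proof.
rewrite (anormE size_bump).
apply: (@le_trans _ _ (\sum_(n < m.*2.+1) cabs (trapezoid_coef n))).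
  apply: ler_sum => n _; rewrite coef_poly ltn_ord cabsM binc_ratio.
  by rewrite ler_piMl ?cabs_ge0// binc_ratio_le1.
rewrite (le_trans (@ler_sum_ord _ (fun n => cabs (trapezoid_coef n)) _ _ mMle
  (fun n => cabs_ge0 _)))//.
under eq_bigr => n _ do rewrite cabs_trapezoid.
rewrite -mulr_suml ler_pdivrMr//.
rewrite (le_trans (sum_mul_le _ (fun n => cabs (arc_sum a n))
  (fun n => cabs (arc_sum (3 * a) n)) ltr01))//.
rewrite !arc_sum_parseval// natrM invr1 !mul1r.
by rewrite !natrM; lra.
Qed.

Let zdist k l : cabs (z ^+ k - z ^+ l) <= 16 / (a%:R * L%:R) * `|k%:R - l%:R|.
Proof.
rewrite !zetaX (le_trans (expi_lipschitz _ _))// MR -mulrBl -mulrBr !normrM.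
rewrite (@ger0_norm _ (pi *+ 2)); last by rewrite mulrn_wge0// pi_ge0.
rewrite (@ger0_norm _ (_^-1)); last by rewrite invr_ge0 mulr_ge0// ltW.
set w := _^-1; set d := `|_|.
rewrite [leLHS](_ : _ = (4 * pi) * (w * d)); last by ring.
rewrite -[leRHS]mulrA ler_wpM2r//; last by have := @pihalf_lt2 R; lra.
by rewrite /w /d mulr_ge0// invr_ge0 mulr_ge0// ltW.
Qed.

(** The arc sum at the frequency one lower, in a form that also makes sense at [n = 0]. *)
Let prev_arc_sum N n : R[i] :=
  \sum_(k < N) ((z ^+ (k * m))^-1 / z ^+ k) * z ^+ (n * k).

Let prev_trapezoid n : R[i] :=
  b ^+ n / b ^+ m.+1 * (prev_arc_sum a n * prev_arc_sum (3 * a) n) / (a * M)%:R.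

Let prev_trapezoidE n : prev_trapezoid n.+1 = trapezoid_coef n.
Proof.
rewrite /prev_trapezoid /trapezoid_coef; congr (_ * _ / _).
  by rewrite !exprS invfM mulrACA mulfV ?mul1r// -[b]expr1.
by congr (_ * _); apply: eq_bigr => k _; rewrite (mulSn n) exprD mulrA divfK.
Qed.

Let prev_arc_sum_parseval N : (N <= M)%N ->
  \sum_(n < M) cabs (prev_arc_sum N n) ^+ 2 = M%:R * N%:R.
Proof.
move=> NM; rewrite (parseval M_gt0 (fun k => (z ^+ (k * m))^-1 / z ^+ k))//.
under eq_bigr => k _ do rewrite cabsM !cabsV !zX1 invr1 mulr1 expr1n.
by rewrite sumr_const card_ord.
Qed.

(** Lowering the frequency by one multiplies the term of index [k] by [(z ^+ k)^-1], which on a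
    short arc is close to the constant [(z ^+ c)^-1]; Parseval turns this into an l^2 estimate. *)
Let arc_sum_diff N c r : (N <= M)%N ->
  (forall k, (k < N)%N -> cabs (z ^+ c - z ^+ k) <= r) ->
  \sum_(n < M) cabs (prev_arc_sum N n - (z ^+ c)^-1 * arc_sum N n) ^+ 2
    <= M%:R * N%:R * r ^+ 2.
Proof.
move=> NM cr.
pose f k := (z ^+ (k * m))^-1 * ((z ^+ k)^-1 - (z ^+ c)^-1).
rewrite (eq_bigr (fun n : 'I_M =>
   cabs (\sum_(k < N) f k * z ^+ (n * k)) ^+ 2)); last first.
  move=> n _; rewrite mulr_sumr -sumrB; congr (cabs _ ^+ 2).
  by apply: eq_bigr => k _; rewrite /f; ring.
rewrite (parseval M_gt0)// -mulrA ler_wpM2l// -[N in N%:R]card_ord mulr_natl.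
rewrite -sumr_const ler_sum// => k _.
rewrite lerXn2r ?nnegrE ?cabs_ge0//; first exact: le_trans (cabs_ge0 _) (cr k _).
rewrite /f cabsM cabsV zX1 invr1 mul1r (le_trans _ (cr k _))//.
rewrite (_ : _ - _ = (z ^+ k)^-1 * (z ^+ c)^-1 * (z ^+ c - z ^+ k)).
  by rewrite 2!cabsM !cabsV !zX1 invr1 !mul1r.
by field; rewrite !z_neq0.
Qed.

Let prev_arc_sum_le N n : cabs (prev_arc_sum N n) <= N%:R.
Proof.
rewrite (le_trans (cabs_sum _ _ _))// -[N in leRHS]card_ord -sumr_const.
rewrite ler_sum// => k _.
by rewrite 2!cabsM !cabsV !zX1 invr1 !mul1r.
Qed.

Let prev_trapezoid_le n : cabs (prev_trapezoid n) <= 3 / L%:R.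
Proof.
rewrite 2!cabsM cabsV cabs_nat cabsM cabsV !bX1 invr1 !mul1r cabsM.
rewrite ler_pdivrMr// (le_trans (ler_pM _ _ (prev_arc_sum_le _ _)
  (prev_arc_sum_le _ _))) ?cabs_ge0//.
rewrite !natrM (_ : 3 / _ * _ = a%:R * (3 * a%:R))//.
by field; rewrite gt_eqF.
Qed.

(** A product rule: the arcs are replaced one at a time, with centres [0] and [2a], whose phases
    combine with [b] to give [xi]. *)
Let trapezoid_diff n : cabs (prev_trapezoid n - xi * trapezoid_coef n) <=
  (cabs (prev_arc_sum a n - (z ^+ 0)^-1 * arc_sum a n) *
     cabs (prev_arc_sum (3 * a) n) +
   cabs (arc_sum a n) *
     cabs (prev_arc_sum (3 * a) n - (z ^+ a.*2)^-1 * arc_sum (3 * a) n))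
  / (a * M)%:R.
Proof.
rewrite (_ : _ - _ = b ^+ n / b ^+ m.+1 *
  ((prev_arc_sum a n - (z ^+ 0)^-1 * arc_sum a n) * prev_arc_sum (3 * a) n +
   arc_sum a n * (prev_arc_sum (3 * a) n - (z ^+ a.*2)^-1 * arc_sum (3 * a) n))
  / (a * M)%:R).
  rewrite 2!cabsM cabsV cabs_nat cabsM cabsV !bX1 invr1 !mul1r.
  rewrite ler_wpM2r ?invr_ge0 ?(ltW aMR_gt0)// (le_trans (cabsD _ _))//.
  by rewrite !cabsM.
have xib : xi = (z ^+ a.*2)^-1 / b.
  by rewrite /b; field; rewrite z_neq0 cabs1_neq0.
rewrite /prev_trapezoid /trapezoid_coef xib expr0 invr1 exprS invfM.
by ring.
Qed.

Let sum_trapezoid_diff :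
  \sum_(n < M) cabs (prev_trapezoid n - xi * trapezoid_coef n) <= 1666 / L%:R.
Proof.
rewrite (le_trans (ler_sum _ (fun (n : 'I_M) _ => trapezoid_diff n)))//.
rewrite -mulr_suml big_split/= ler_pdivrMr//.
(* In l^2 the differences are smaller than the arc sums by a factor of order [1 / L], hence the
   balancing weight [L]. *)
have s1 := sum_mul_le M
  (fun n => cabs (prev_arc_sum a n - (z ^+ 0)^-1 * arc_sum a n))
  (fun n => cabs (prev_arc_sum (3 * a) n)) L_gt0.
have s2 := sum_mul_le M
  (fun n => cabs (prev_arc_sum (3 * a) n - (z ^+ a.*2)^-1 * arc_sum (3 * a) n))
  (fun n => cabs (arc_sum a n)) L_gt0.
rewrite prev_arc_sum_parseval// in s1; rewrite arc_sum_parseval// in s2.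
have d1 := @arc_sum_diff a 0 (16 / L%:R) aM.
have d2 := @arc_sum_diff (3 * a) a.*2 (32 / L%:R) aM3.
have {}d1 := d1 _; have {}d2 := d2 _.
have /d1{}d1 : forall k, (k < a)%N -> cabs (z ^+ 0 - z ^+ k) <= 16 / L%:R.
  move=> k ka; rewrite (le_trans (zdist _ _))// sub0r normrN normr_nat.
  have kd : k%:R <= a%:R :> R by rewrite ler_nat ltnW.
  rewrite (le_trans (ler_wpM2l _ kd))//.
  rewrite le_eqVlt; apply/orP; left; apply/eqP.
  by field; rewrite !gt_eqF.
have /d2{}d2 : forall k, (k < 3 * a)%N -> cabs (z ^+ a.*2 - z ^+ k) <= 32 / L%:R.
  move=> k ka; rewrite (le_trans (zdist _ _))//.
  have kd : `|a.*2%:R - k%:R| <= 2 * a%:R :> R.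
    have : (k%:R <= (3 * a)%:R :> R) by rewrite ler_nat ltnW.
    rewrite ler_norml -mul2n !natrM => ?; apply/andP; split.
      by have : 0 < a%:R :> R by []; lra.
    by have : 0 <= k%:R :> R by []; lra.
  rewrite (le_trans (ler_wpM2l _ kd))//.
  rewrite le_eqVlt; apply/orP; left; apply/eqP.
  by field; rewrite !gt_eqF.
have w0 : 0 < L%:R^-1 :> R by rewrite invr_gt0.
have t0 : 0 < M%:R * a%:R :> R by rewrite mulr_gt0// ltr0n.
under [X in _ + X]eq_bigr => n _ do rewrite mulrC.
rewrite (le_trans (lerD s1 s2))//.
apply: (@le_trans _ _ (
  ((L%:R * (M%:R * a%:R * (16 / L%:R) ^+ 2)) + L%:R^-1 * (M%:R * (3 * a)%:R)) / 2
 + ((L%:R * (M%:R * (3 * a)%:R * (32 / L%:R) ^+ 2)) + L%:R^-1 * (M%:R * a%:R)) / 2)).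
  by apply: lerD; rewrite ler_wpM2r ?invr_ge0// lerD2r ler_wpM2l// ltW.
rewrite le_eqVlt; apply/orP; left; apply/eqP.
rewrite !natrM; field; rewrite gt_eqF//.
Qed.

Let coef_bump n : bump_poly`_n =
  ('C(m.*2, n)%:R / 'C(m.*2, m)%:R) * trapezoid_coef n.
Proof.
rewrite coef_poly; case: ltnP => // mn.
by rewrite bin_small ?mul0r.
Qed.

(** Summation by parts: the variation of the binomial weights contributes [6 / L], the differences
    of the trapezoid coefficients [1666 / L]. *)
Lemma anorm_bump_Xsub : anorm (bump_poly * ('X - xi%:P)) <= 2000 / L%:R.
Proof.
rewrite (@anormE _ _ m.*2.+2); last first.
  rewrite (leq_trans (size_polyMleq _ _))// size_XsubC addn2 /=.
  by rewrite ltnS size_bump.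
pose w : R := ('C(m.*2, m)%:R)^-1.
have w0 : 0 <= w by rewrite invr_ge0.
have E n : (bump_poly * ('X - xi%:P))`_n =
    ((bin_prev m n - 'C(m.*2, n)%:R) * w)%:C * prev_trapezoid n +
    ('C(m.*2, n)%:R * w)%:C * (prev_trapezoid n - xi * trapezoid_coef n).
  rewrite mulrBr coefB coefMX coefMC.
  have -> : (if n == 0%N then 0 else bump_poly`_n.-1) =
      (bin_prev m n * w)%:C * prev_trapezoid n.
    case: n => [|n] /=; first by rewrite mul0r mul0r.
    rewrite coef_bump prev_trapezoidE /w rmorphM fmorphV/= !rmorph_nat.
    by [].
  rewrite coef_bump mulrBl rmorphB !rmorphM /w fmorphV/= !rmorph_nat.
  by ring.
apply: (@le_trans _ _ (\sum_(n < m.*2.+2)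
   (`|bin_prev m n - 'C(m.*2, n)%:R| * (w * (3 / L%:R)) +
    cabs (prev_trapezoid n - xi * trapezoid_coef n)))).
  apply: ler_sum => n _; rewrite E (le_trans (cabsD _ _))// lerD//.
    by rewrite cabsM cabsR normrM (ger0_norm w0) -mulrA ler_wpM2l// ler_wpM2l.
  by rewrite cabsM cabsR ger0_norm ?mulr_ge0// ler_piMl ?cabs_ge0.
rewrite big_split/= -mulr_suml.
apply: (@le_trans _ _ (6 / L%:R + 1666 / L%:R)); last first.
  by rewrite -mulrDl ler_wpM2r ?invr_ge0 ?(ltW L_gt0)//; lra.
apply: lerD; last first.
  rewrite (le_trans _ sum_trapezoid_diff)//.
  exact: (@ler_sum_ord _ (fun n => cabs (prev_trapezoid n - xi * trapezoid_coef n))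
    _ _ mM (fun n => cabs_ge0 _)).
rewrite (le_trans (ler_wpM2r _ (bin_variation m))) ?mulr_ge0//.
rewrite le_eqVlt; apply/orP; left; apply/eqP.
by rewrite /w; field; rewrite !gt_eqF.
Qed.

Let radius : R := cabs (expi (pi *+ 2 / L%:R) - 1).

(** Since [a / M = 1 / L], these indices have angles at least [2 pi / L] away from 0 on either
    side. *)
Let zX_far j : (a <= j <= M - a)%N -> radius <= cabs (z ^+ j - 1).
Proof.
move=> /andP[aj jM]; rewrite -(@ler_pXn2r _ 2) ?nnegrE ?cabs_ge0//.
rewrite zetaX !cabs_expiB1 lerD2l lerN2 ler_pM2l//.
have pi2 : 0 < pi *+ 2 :> R by rewrite mulrn_wgt0// pi_gt0.
have ajR : a%:R <= j%:R :> R by rewrite ler_nat.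
have jMR : j%:R <= M%:R - a%:R :> R by rewrite -natrB ?ler_nat.
have MR0 : 0 < M%:R :> R by rewrite ltr0n.
have -> : pi *+ 2 / L%:R = pi *+ 2 * a%:R / M%:R :> R.
  by rewrite MR; field; rewrite !gt_eqF.
have L3R : 3 <= L%:R :> R by rewrite ler_nat.
apply: cos_le_away; apply/andP; split.
- by rewrite divr_ge0// mulr_ge0// ltW.
- rewrite ler_pdivrMr// MR -subr_ge0.
  rewrite (_ : _ - _ = pi * a%:R * (L%:R - 2)); last by ring.
  by rewrite mulr_ge0 ?mulr_ge0 ?pi_ge0//; lra.
- by rewrite ler_pM2r ?invr_gt0// ler_pM2l// mulrn_wgt0.
rewrite lerBrDr -mulrDl ler_pdivrMr// -mulrDr ler_pM2l//.
by rewrite -lerBrDr.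
Qed.

(** For [w] and [x] on the circle this is [w^m |1 + x w|^(2m)], which peaks at [x = w^-1]. *)
Let kernel w x : R[i] := (x ^+ m)^-1 * (1 + x * w) ^+ m.*2.

Let sum_kernel N1 N2 w :
  \sum_(k < N1) \sum_(l < N2) kernel w (b * z ^+ (k + l)) =
  \sum_(n < m.*2.+1) 'C(m.*2, n)%:R * w ^+ n *
     (b ^+ n / b ^+ m * (arc_sum N1 n * arc_sum N2 n)).
Proof.
rewrite /arc_sum.
under [RHS]eq_bigr => n _.
  rewrite mulr_suml !mulr_sumr.
  under eq_bigr => k _ do rewrite mulr_sumr !mulr_sumr.
  over.
rewrite [RHS]exchange_big; apply: eq_bigr => k _ /=.
rewrite [RHS]exchange_big; apply: eq_bigr => l _ /=.
rewrite /kernel exprDn mulr_sumr; apply: eq_bigr => n _.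
rewrite expr1n mul1r !exprMn -!exprM !mulnDl !exprD (mulnC n) (mulnC n) -mulr_natl.
rewrite (mulnC l n) (mulnC k n) !invfM.
by ring.
Qed.

Let arc_sum_full n : (n <= m.*2)%N -> arc_sum M n = M%:R *+ (n == m).
Proof.
move=> nm; rewrite -(zeta_orth M_gt0 (a := n) (b := m)); last 2 first.
- by rewrite (leq_trans _ mMle).
- by rewrite (leq_trans _ mMle)// ltnS.
by apply: eq_bigr => k _; rewrite mulrC (mulnC n).
Qed.

Let arc_sum_center N : arc_sum N m = N%:R.
Proof.
rewrite /arc_sum; under eq_bigr => k _ do rewrite (mulnC m) mulVf//.
by rewrite sumr_const card_ord.
Qed.

Let kernel_far w k l : cabs w = 1 -> cabs (w - xi) <= radius / 2 ->
  (k < a)%N -> (3 * a <= l < M)%N ->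
  cabs (kernel w (b * z ^+ (k + l))) <= 4 ^+ m * (1 - radius ^+ 2 / 16) ^+ m.
Proof.
move=> w1 wxi ka alM.
pose j := (k + l - a.*2)%N.
have [jlim klj] := far_index ka alM.
set x := b * _; have x1 : cabs x = 1 by rewrite cabsM b1 zX1 mulr1.
have xw : x * w = z ^+ j * (w / xi).
  rewrite /x /b klj -/j.
  by rewrite exprD; field; rewrite z_neq0 cabs1_neq0.
have xw1 : cabs (x * w) = 1 by rewrite cabsM x1 w1 mulr1.
have far : radius / 2 <= cabs (1 - x * w).
  have /le_trans : radius <= cabs (z ^+ j - 1) by exact: zX_far.
  have := cabsD (z ^+ j - x * w) (x * w - 1).
  rewrite addrA subrK => t /(_ _ t).
  have -> : cabs (z ^+ j - x * w) = cabs (w - xi).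
    rewrite xw (_ : _ - _ = z ^+ j * (xi - w) / xi).
      by rewrite !cabsM cabsV zX1 xi1 invr1 mul1r mulr1 cabsC.
    by field; rewrite cabs1_neq0.
  by rewrite (cabsC 1); lra.
rewrite /kernel cabsM cabsV !cabsX x1 expr1n invr1 mul1r -mul2n exprM -exprMn.
(* The parallelogram identity for the unit vectors 1 and [x * w]. *)
have e : cabs (1 + x * w) ^+ 2 = 4 - cabs (1 - x * w) ^+ 2.
  have : cabs (x * w) ^+ 2 = 1 by rewrite xw1 expr1n.
  rewrite !cabs_sqr; case: (x * w) => c s /= cs.
  rewrite [LHS](_ : _ = 1 + 2 * c + (c ^+ 2 + s ^+ 2)); last by ring.
  rewrite [RHS](_ : _ = 3 + 2 * c - (c ^+ 2 + s ^+ 2)); last by ring.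
  by rewrite cs; ring.
have r0 : 0 <= radius := cabs_ge0 _.
have s0 := sqr_ge0 (cabs (1 + x * w)).
have : (radius / 2) ^+ 2 <= cabs (1 - x * w) ^+ 2.
  by rewrite ler_pXn2r ?nnegrE ?cabs_ge0// divr_ge0.
rewrite expr_div_n => far2.
by rewrite lerXn2r ?nnegrE ?e//; rewrite ?e in s0 *; lra.
Qed.

(** After normalisation, the kernel summed over all [l < M] is exactly [w ^+ m], and over [l < 3a]
    it is the bump. The difference consists of far terms, whose [4 ^+ m] is absorbed by the central
    binomial coefficient at the cost of a factor [2m + 1]. *)
Lemma bump_plateau w : cabs w = 1 -> cabs (w - xi) <= radius / 2 ->
  cabs (w ^+ m - bump_poly.[w]) <= m.*2.+1%:R * (1 - radius ^+ 2 / 16) ^+ m.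
Proof.
move=> w1 wxi; set q := 1 - _.
pose C : R[i] := 'C(m.*2, m)%:R.
have C0 : C != 0 by rewrite pnatr_eq0 -lt0n bin_gt0.
have [D DE] : exists D : R[i], D = (a * M)%:R by exists (a * M)%:R.
have D0 : D != 0 by rewrite DE pnatr_eq0 -lt0n muln_gt0 M_gt0.
pose G N := \sum_(k < a) \sum_(l < N) kernel w (b * z ^+ (k + l)).
(* Over a full period only the central frequency survives. *)
have GM : G M = C * w ^+ m * D.
  rewrite /G sum_kernel (bigD1 (inord m))//= big1 ?addr0 => [|n nm].
    rewrite inordK ?ltnS// arc_sum_full ?eqxx//.
    by rewrite arc_sum_center mulfV// mul1r DE natrM.
  rewrite arc_sum_full; last by rewrite -ltnS.
  have -> : (n == m :> nat) = false.
    by apply: contraNF nm => /eqP nm; apply/eqP/val_inj; rewrite /= nm inordK.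
  by rewrite mulr0n !mulr0.
have G3 : G (3 * a)%N = bump_poly.[w] * C * D.
  rewrite /G sum_kernel horner_poly !mulr_suml; apply: eq_bigr => n _.
  by rewrite /trapezoid_coef -DE -/C; field; rewrite C0 D0 b_neq0.
have -> : w ^+ m - bump_poly.[w] = (G M - G (3 * a)%N) / (C * D).
  by rewrite GM G3; field; rewrite C0 D0.
rewrite cabsM cabsV DE -natrM cabs_nat ler_pdivrMr; last first.
  by rewrite ltr0n muln_gt0 bin_gt0 muln_gt0 M_gt0 m2.
have -> : G M - G (3 * a)%N = \sum_(k < a) \sum_(3 * a <= l < M)
    kernel w (b * z ^+ (k + l)).
  rewrite /G -sumrB; apply: eq_bigr => k _.
  rewrite -!(big_mkord xpredT (fun l => kernel w (b * z ^+ (k + l)))).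
  by rewrite (@big_cat_nat _ _ _ (3 * a)%N)//= addrAC subrr add0r.
have q0 : 0 <= q.
  rewrite /q subr_ge0 ler_pdivrMr// mul1r (_ : 16 = 4 ^+ 2); last by ring.
  rewrite ler_pXn2r ?nnegrE ?cabs_ge0// (le_trans (cabsB _ _))//.
  by rewrite cabs_expi cabs1; lra.
pose t : R := 4 ^+ m * q ^+ m.
have t0 : 0 <= t by rewrite mulr_ge0 ?exprn_ge0.
apply: (@le_trans _ _ (a%:R * (M%:R * t))).
  rewrite (le_trans (cabs_sum _ _ _))// -[a in leRHS]card_ord mulr_natl.
  rewrite -sumr_const ler_sum// => k _.
  rewrite (le_trans (cabs_sum _ _ _))//.
  rewrite (@le_trans _ _ (\sum_(3 * a <= l < M) t))//.
    by apply: ler_sum_nat => l lM; exact: kernel_far.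
  by rewrite sumr_const_nat -[leLHS]mulr_natl ler_wpM2r// ler_nat leq_subr.
rewrite (natrM _ 'C(_, _)) (natrM _ a) [leLHS]mulrA.
rewrite [leRHS](_ : _ = a%:R * M%:R *
  ((m.*2.+1)%:R * 'C(m.*2, m)%:R * q ^+ m)); last by ring.
rewrite ler_wpM2l ?mulr_ge0// ler_wpM2r ?exprn_ge0//.
by rewrite -natrX -natrM ler_nat bin_central_ge.
Qed.

End Bump.

(** The width [1 / L] is fixed by [eps] alone, so [r] and [q] depend neither on [m] nor on [xi]. *)
Lemma exists_bump (R : realType) (eps : R) : 0 < eps ->
  exists2 r : R, 0 < r & exists2 q : R, 0 <= q < 1 &
  forall (m : nat) (xi : R[i]), cabs xi = 1 -> exists p : {poly R[i]},
  [/\ (size p <= m.*2.+1)%N, anorm p <= 2, anorm (p * ('X - xi%:P)) <= eps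
    & forall w, cabs w = 1 -> cabs (w - xi) <= r ->
      cabs (w ^+ m - p.[w]) <= m.*2.+1%:R * q ^+ m].
Proof.
move=> eps0.
pose L := maxn 3 (Num.truncn (2000 / eps)).+1.
have L3 : (3 <= L)%N by rewrite leq_maxl.
have L0 : 0 < L%:R :> R by rewrite ltr0n (leq_trans _ L3).
have Leps : 2000 / L%:R <= eps.
  rewrite ler_pdivrMr// mulrC -ler_pdivrMr//.
  rewrite (le_trans (ltW (truncnS_gt _)))//.
  by rewrite ler_nat leq_maxr.
pose r : R := cabs (expi (pi *+ 2 / L%:R) - 1).
have r0 : 0 < r.
  rewrite lt_neqAle cabs_ge0 andbT eq_sym -(@eqrXn2 _ 2) ?cabs_ge0// expr0n.
  rewrite cabs_expiB1 gt_eqF// subr_gt0 gtr_pMr// cos_lt1//.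
  have pi2 : 0 < pi *+ 2 :> R by rewrite mulrn_wgt0// pi_gt0.
  rewrite divr_gt0//= ltr_pdivrMr// ltr_pMr// ltr1n.
  by rewrite (leq_trans _ L3).
have r2 : r <= 2.
  by rewrite (le_trans (cabsB _ _))// cabs_expi cabs1; lra.
exists (r / 2); first by rewrite divr_gt0.
exists (1 - r ^+ 2 / 16); first by apply/andP; split; nra.
move=> m xi xi1; exists (bump_poly L m xi); split.
- exact: size_bump.
- exact: anorm_bump.
- exact: le_trans (anorm_bump_Xsub m L3 xi1) Leps.
- by move=> w w1 wxi; exact: bump_plateau.
Qed.

(** * Polynomials of a linear isometry *)

Section PolynomialAction.
Context {R : realType} {V : normedModType R[i]}.
Variable S : {linear V -> V}.
Hypothesis S_isom : forall v, rnorm (S v) = rnorm v.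
Implicit Types (p q : {poly R[i]}) (u v w : V).

Definition pact p v : V := \sum_(i < size p) p`_i *: iter i S v.

Lemma pactE p N v : (size p <= N)%N ->
  pact p v = \sum_(i < N) p`_i *: iter i S v.
Proof.
move=> pN; rewrite /pact (big_ord_widen _ (fun i => p`_i *: iter i S v) pN).
rewrite big_mkcond /=; apply: eq_bigr => i _.
by case: ltnP => // pi; rewrite nth_default// scale0r.
Qed.

Lemma pact0 v : pact 0 v = 0.
Proof. by rewrite /pact size_poly0 big_ord0. Qed.

Lemma pactD p q v : pact (p + q) v = pact p v + pact q v.
Proof.
pose N := maxn (size p) (size q).
rewrite (@pactE _ N) ?(leq_trans (size_polyD _ _))//.
rewrite (@pactE p N) ?leq_maxl// (@pactE q N) ?leq_maxr// -big_split.
by apply: eq_bigr => i _; rewrite coefD scalerDl.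
Qed.

Lemma pactCM c p v : pact (c%:P * p) v = c *: pact p v.
Proof.
rewrite (@pactE _ (size p)).
  by rewrite scaler_sumr; apply: eq_bigr => i _; rewrite coefCM scalerA.
by rewrite mul_polyC size_scale_leq.
Qed.

Lemma pactMX p v : pact (p * 'X) v = pact p (S v).
Proof.
rewrite (@pactE _ (size p).+1); last first.
  by rewrite (leq_trans (size_polyMleq _ _))// size_polyX addn2.
rewrite big_ord_recl coefMX eqxx scale0r add0r; apply: eq_bigr => i _.
by rewrite coefMX /= -iterSr.
Qed.

Lemma pact_lin p v : pact p (S v) = S (pact p v).
Proof.
rewrite linear_sum; apply: eq_bigr => i _.
by rewrite linearZ/= -iterS iterSr.
Qed.

Lemma pact1 v : pact 1 v = v.
Proof. by rewrite /pact size_poly1 big_ord1 coefC scale1r. Qed.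

Lemma pactM p q v : pact (p * q) v = pact p (pact q v).
Proof.
elim/poly_ind: p q v => [|p c IH] q v; first by rewrite mul0r !pact0.
rewrite mulrDl -mulrA (mulrC 'X) !pactD IH pactMX pactCM.
by rewrite pactMX pact_lin -[c%:P in RHS]mulr1 pactCM pact1.
Qed.

Lemma pactN p v : pact (- p) v = - pact p v.
Proof. by rewrite -mulN1r -polyCN pactCM scaleN1r. Qed.

Lemma pactXn n v : pact 'X^n v = iter n S v.
Proof.
by elim: n v => [|n IH] v; rewrite ?pact1// exprSr pactMX IH -iterSr.
Qed.

Lemma pact_iter p n v : pact p (iter n S v) = iter n S (pact p v).
Proof. by rewrite -!pactXn -!pactM mulrC. Qed.

Lemma pactDr p v w : pact p (v + w) = pact p v + pact p w.
Proof.
have itD i : iter i S (v + w) = iter i S v + iter i S w.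
  by elim: i => //= i ->; rewrite linearD.
by rewrite /pact -big_split; apply: eq_bigr => i _; rewrite itD scalerDr.
Qed.

Lemma pactBr p v w : pact p (v - w) = pact p v - pact p w.
Proof. by apply/eqP; rewrite -subr_eq0 opprB addrA subr_eq0 -pactDr subrK. Qed.

Lemma pactXsub c v : pact ('X - c%:P) v = S v - c *: v.
Proof.
rewrite pactD pactN -[c%:P]mulr1 pactCM pact1.
by rewrite -['X]expr1 pactXn.
Qed.

Lemma rnorm_sum (I : Type) (r : seq I) (P : pred I) (F : I -> V) :
  rnorm (\sum_(i <- r | P i) F i) <= \sum_(i <- r | P i) rnorm (F i).
Proof.
elim/big_rec2: _ => [|i y1 y2 _ IH]; first by rewrite rnorm0.
by rewrite (le_trans (rnormD _ _))// lerD2l.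
Qed.

Lemma rnorm_iter n v : rnorm (iter n S v) = rnorm v.
Proof. by elim: n => //= n IH; rewrite S_isom. Qed.

Lemma rnorm_pact p v : rnorm (pact p v) <= anorm p * rnorm v.
Proof.
rewrite (le_trans (rnorm_sum _ _ _))// mulr_suml ler_sum// => i _.
by rewrite rnormZ rnorm_iter.
Qed.

End PolynomialAction.

Lemma ler_sum_const (R : realType) (N : nat) (F : 'I_N -> R) (c : R) :
  (forall i, F i <= c) -> \sum_(i < N) F i <= N%:R * c.
Proof.
move=> Fc; rewrite (le_trans (ler_sum _ (fun i _ => Fc i)))//.
by rewrite sumr_const card_ord mulr_natl.
Qed.

(** * Spectral densities and quadrature over roots of unity *)

Section Quadrature.
Context {R : realType} {V : normedModType R[i]}.
Variable S : {linear V -> V}.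
Hypothesis S_isom : forall v, rnorm (S v) = rnorm v.
Variable K : nat.
Implicit Types (p h : {poly R[i]}) (u v w : V) (z : R[i]).

Let twist z n v : V := (z ^+ n)^-1 *: iter n S v.

(* The spectral density of u at z, smoothed by a de la Vallee-Poussin kernel
   that reproduces the exponents K, ..., 2K. *)
Definition density z u : V :=
  (K.+1%:R)^-1 *: \sum_(i < K.+1) \sum_(k < K.*2.+2) twist z (i + k) u.

Let twistD z i k v : twist z (i + k) v = twist z i (twist z k v).
Proof.
have itZ c x : iter i S (c *: x) = c *: iter i S x.
  by elim: i => //= i ->; rewrite linearZ.
by rewrite /twist iterD exprD invfM -scalerA itZ.
Qed.

Let twist_linear z n : linear (twist z n).
Proof.
move=> a v w; rewrite /twist.
have -> : iter n S (a *: v + w) = a *: iter n S v + iter n S w.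
  by elim: n => //= n ->; rewrite linearP.
by rewrite scalerDr !scalerA (mulrC a).
Qed.

Let twistB z n v w : twist z n (v - w) = twist z n v - twist z n w.
Proof. by rewrite -scaleN1r addrC twist_linear scaleN1r addrC. Qed.

Let twist0 z n : twist z n 0 = 0.
Proof. by rewrite -[X in twist _ _ X](subrr 0) twistB subrr. Qed.

Let twistZ z n a v : twist z n (a *: v) = a *: twist z n v.
Proof.
by rewrite -[a *: v]addr0 twist_linear twist0 addr0.
Qed.

Let twist_sum z n (I : finType) (F : I -> V) :
  twist z n (\sum_i F i) = \sum_i twist z n (F i).
Proof.
elim/big_rec2: _ => [|i y1 y2 _ <-]; first exact: twist0.
by rewrite -[F i]scale1r twist_linear !scale1r.
Qed.

Let rnorm_twist z n v : cabs z = 1 -> rnorm (twist z n v) = rnorm v.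
Proof.
move=> z1; rewrite rnormZ rnorm_iter// -/(cabs _) cabsV cabsX z1.
by rewrite expr1n invr1 mul1r.
Qed.

Let rnorm_inv (v : V) N : rnorm ((N.+1%:R)^-1 *: v) = rnorm v / N.+1%:R.
Proof. by rewrite rnormZ -/(cabs _) cabsV cabs_nat mulrC. Qed.

(** The exponents [K + j] and [i + k] all lie below [M], so orthogonality suffers no aliasing; for
    given [j], each [i] meets exactly one [k] with [i + k = K + j]. *)
Lemma quadrature h u : (size h <= K.+1)%N ->
  let M := (4 * K.+1)%N in
  iter K S (pact S h u) = (M%:R)^-1 *: \sum_(r < M)
    ((zeta M ^+ r) ^+ K * h.[zeta M ^+ r]) *: density (zeta M ^+ r) u.
Proof.
move=> hK M; pose z : R[i] := zeta M.
have M0 : (0 < M)%N by rewrite /M; lia.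
have MR0 : M%:R != 0 :> R[i] by rewrite pnatr_eq0 -lt0n.
have KR0 : K.+1%:R != 0 :> R[i] by rewrite pnatr_eq0.
apply: (scalerI MR0); rewrite scalerA mulfV// scale1r.
apply: (scalerI KR0); rewrite scaler_sumr.
transitivity (\sum_(r < M) \sum_(j < K.+1) \sum_(i < K.+1) \sum_(k < K.*2.+2)
   (h`_j * (z ^+ (r * (K + j)) / z ^+ (r * (i + k)))) *: iter (i + k) S u);
   last first.
  apply: eq_bigr => r _; rewrite /density !scalerA -/z.
  have -> c : K.+1%:R * c / K.+1%:R = c :> R[i] by rewrite mulrAC mulfV// mul1r.
  rewrite (horner_coef_wide _ hK) mulr_sumr scaler_suml.
  apply: eq_bigr => j _; rewrite scaler_sumr; apply: eq_bigr => i _.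
  rewrite scaler_sumr; apply: eq_bigr => k _.
  rewrite /twist scalerA; congr (_ *: _).
  by rewrite !exprM exprD; ring.
rewrite exchange_big /= -pactXn -pactM mulrC pactM pactXn (pactE _ _ hK).
rewrite !scaler_sumr; apply: eq_bigr => j _.
rewrite exchange_big /= -[X in X%:R *: _]card_ord scaler_nat -sumr_const.
apply: eq_bigr => i _; rewrite exchange_big /=.
have orth (k : 'I_K.*2.+2) :
    \sum_(r < M) (h`_j * (z ^+ (r * (K + j)) / z ^+ (r * (i + k)))) *:
      iter (i + k) S u
    = (h`_j * (M%:R *+ (K + j == i + k)%N)) *: iter (i + k) S u.
  rewrite -scaler_suml -mulr_sumr zeta_orth//; rewrite /M.
    by have := ltn_ord j; lia.
  by have := ltn_ord i; have := ltn_ord k; lia.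
rewrite (eq_bigr _ (fun k _ => orth k)) {orth}.
have jK := ltn_ord j; have iK := ltn_ord i.
have kE : (inord (K + j - i) : 'I_K.*2.+2) = (K + j - i)%N :> nat.
  by rewrite inordK//; lia.
rewrite (bigD1 (inord (K + j - i)))//= [X in _ + X]big1 ?addr0.
  rewrite kE subnKC ?eqxx; last by lia.
  by rewrite mulr1n scalerA mulrC addnC iterD.
move=> k kn; have -> : (K + j == i + k)%N = false.
  by apply: contraNF kn => /eqP e; apply/eqP/val_inj; rewrite /= kE; lia.
by rewrite mulr0n mulr0 scale0r.
Qed.

Lemma rnorm_density z u : cabs z = 1 ->
  rnorm (density z u) <= K.*2.+2%:R * rnorm u.
Proof.
move=> z1; rewrite rnorm_inv ler_pdivrMr ?ltr0n//.
rewrite (le_trans (rnorm_sum _ _ _))// [leRHS]mulrC ler_sum_const// => i.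
rewrite (le_trans (rnorm_sum _ _ _))// ler_sum_const// => k.
by rewrite rnorm_twist.
Qed.

Let twist_telescope z N v : z != 0 ->
  \sum_(k < N) twist z k (z *: v - S v) = z *: (v - twist z N v).
Proof.
move=> z0; elim: N => [|N IH].
  by rewrite big_ord0 /twist expr0 invr1 scale1r subrr scaler0.
rewrite big_ord_recr /= IH twistB twistZ scalerBr scalerBr addrA subrK.
congr (_ - _); rewrite /twist exprS invfM scalerA mulrA mulfV// mul1r.
by rewrite -iterSr.
Qed.

(** On the range of [(z - S)^2] both sums telescope, one for each factor, leaving four terms of norm
    [rnorm w]; the error gets the trivial bound. *)
Lemma rnorm_density_resolved z u w e : cabs z = 1 ->
  rnorm (u - (z *: (z *: w - S w) - S (z *: w - S w))) <= e ->
  rnorm (density z u) <= 4 * rnorm w / K.+1%:R + K.*2.+2%:R * e.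
Proof.
move=> z1; set v := z *: w - S w; set u' := z *: v - S v => ue.
have z0 := cabs1_neq0 z1.
have -> : density z u = density z u' + density z (u - u').
  rewrite /density -scalerDr -big_split; congr (_ *: _); apply: eq_bigr => i _.
  rewrite -big_split; apply: eq_bigr => k _ /=.
  by rewrite (twistB _ _ u u') addrCA subrr addr0.
rewrite (le_trans (rnormD _ _))// lerD//; last first.
  by rewrite (le_trans (rnorm_density _ z1))// ler_wpM2l.
rewrite rnorm_inv ler_wpM2r ?invr_ge0//.
(* A preimage under [z - S] of the telescoped sum over [i]. *)
pose x := z *: (w - twist z K.+1 w).
have twistS n y : twist z n (S y) = S (twist z n y).
  by rewrite /twist linearZ/= -iterS iterSr.
have -> : \sum_(i < K.+1) \sum_(k < K.*2.+2) twist z (i + k) u' =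
    z *: (x - twist z K.*2.+2 x).
  rewrite -twist_telescope// exchange_big /=; apply: eq_bigr => k _.
  under eq_bigr => i _ do rewrite addnC twistD.
  rewrite -twist_sum twist_telescope//; congr (twist _ _ _).
  have SZ c y : S (c *: y) = c *: S y by rewrite linearZ.
  have SB y1 y2 : S (y1 - y2) = S y1 - S y2 by rewrite linearB.
  rewrite /x SZ -scalerBr; congr (_ *: _).
  rewrite /v twistB twistZ twistS SB scalerBr !opprB addrACA [RHS]addrACA.
  by congr (_ + _); exact: addrC.
rewrite rnormZ -/(cabs _) z1 mul1r (le_trans (rnormD _ _))// rnormN rnorm_twist//.
have : rnorm x <= 2 * rnorm w.
  rewrite /x rnormZ -/(cabs _) z1 mul1r (le_trans (rnormD _ _))//.
  by rewrite rnormN rnorm_twist//; lra.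
by lra.
Qed.

(** The average in [quadrature] is at most its largest term, and the power [K] of the isometry
    preserves norms. *)
Lemma rnorm_pact_le h u e : (size h <= K.+1)%N ->
  (forall t, 0 <= t <= pi *+ 2 ->
    cabs h.[expi t] * rnorm (density (expi t) u) <= e) ->
  rnorm (pact S h u) <= e.
Proof.
move=> hK he; rewrite -(rnorm_iter S_isom K) (quadrature u hK) /=.
set M := (4 * K.+1)%N; have M0 : (0 < M)%N by rewrite /M; lia.
have MR0 : 0 < M%:R :> R by rewrite ltr0n.
rewrite rnormZ -/(cabs _) cabsV cabs_nat ler_pdivrMl//.
rewrite (le_trans (rnorm_sum _ _ _))// ler_sum_const// => r.
rewrite rnormZ -/(cabs _) cabsM cabsX cabs_zetaX expr1n mul1r zetaX he//.
have pi2 : 0 < pi *+ 2 :> R by rewrite mulrn_wgt0// pi_gt0.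
apply/andP; split; first by rewrite divr_ge0// mulr_ge0// ltW.
by rewrite ler_pdivrMr// ler_pM2l// ler_nat ltnW.
Qed.

End Quadrature.

(** * Numerical estimates for the choice of [m] *)

Lemma ler_product_chain (R : realFieldType) (A U a k W M Q T : R) :
  0 <= A -> 0 <= U -> 0 <= W -> 0 <= Q ->
  a * k <= W * M ^+ 2 -> M ^+ 2 * Q <= T / M ->
  A * (a * Q) * (k * U) <= A * W * U * T / M.
Proof.
move=> A0 U0 W0 Q0 ak MQ.
rewrite [leLHS](_ : _ = A * U * Q * (a * k)); last by ring.
apply: (@le_trans _ _ (A * U * Q * (W * M ^+ 2))).
  by rewrite ler_wpM2l ?mulr_ge0.
rewrite [leLHS](_ : _ = A * U * W * (M ^+ 2 * Q)); last by ring.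
rewrite [leRHS](_ : _ = A * U * W * (T / M)); last by ring.
by rewrite ler_wpM2l ?mulr_ge0.
Qed.

(** With [K = 2 m n], the trivial bound [2K + 2] on densities grows at most linearly in [m]. *)
Lemma notch_degree_le m n : ((m.*2 * n).*2.+2 <= (4 * n + 2) * m.+1)%N.
Proof. rewrite -!mul2n; nia. Qed.

(** With [x = 1 - q], one has [q <= exp(-x)] and [exp(x m / 3) >= 1 + x m / 3 >= x (m + 1) / 3]; the
    latter is cubed. *)
Lemma sqr_geometric_le (R : realType) (q : R) (m : nat) : 0 <= q < 1 ->
  m.+1%:R ^+ 2 * q ^+ m <= (3 / (1 - q)) ^+ 3 / m.+1%:R.
Proof.
move=> /andP[q0 q1]; set x := 1 - q.
have x0 : 0 < x by rewrite subr_gt0.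
have x1 : x <= 1 by rewrite gerBl.
have m0 : 0 < m.+1%:R :> R by rewrite ltr0n.
have mE : m.+1%:R = m%:R + 1 :> R by rewrite natr1.
have mge : 0 <= m%:R :> R by [].
have qm : q ^+ m <= (expR (x * m%:R / 3) ^+ 3)^-1.
  rewrite -expRM_natr divfK ?pnatr_eq0// -expRN -mulNr expRM_natr.
  rewrite lerXn2r ?nnegrE ?expR_ge0//.
  by rewrite (le_trans _ (expR_ge1Dx _))// /x; lra.
have p0 : 0 < x / 3 * m.+1%:R by rewrite mulr_gt0// divr_gt0.
have e1 : x / 3 * m.+1%:R <= expR (x * m%:R / 3).
  by rewrite (le_trans _ (expR_ge1Dx _))// mE; nra.
have e3 : (x / 3 * m.+1%:R) ^+ 3 <= expR (x * m%:R / 3) ^+ 3.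
  by rewrite lerXn2r ?nnegrE ?expR_ge0// ltW.
have : q ^+ m <= ((x / 3 * m.+1%:R) ^+ 3)^-1.
  by rewrite (le_trans qm)// lef_pV2 ?posrE ?exprn_gt0 ?expR_gt0.
move=> /(ler_wpM2l (sqr_ge0 m.+1%:R)) /le_trans; apply.
rewrite le_eqVlt; apply/orP; left; apply/eqP.
by field; rewrite !gt_eqF//; lra.
Qed.

(** * Vanishing of a vector with countably many exceptional points *)

Section CountableSpectrum.
Context {R : realType} {V : normedModType R[i]}.
Variable S : {linear V -> V}.
Hypothesis S_isom : forall v, rnorm (S v) = rnorm v.
Variable u : V.

(** Approximate solvability of [(z - S)^2 w = u], with a bound on [w] uniform in the error; the
    square provides both telescopings of [density]. *)
Definition resolved (C : R) (z : R[i]) := forall d : R, 0 < d ->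
  exists2 w : V, rnorm w <= C &
    rnorm (u - (z *: (z *: w - S w) - S (z *: w - S w))) <= d.

Definition approx_range (z : R[i]) := forall d : R, 0 < d ->
  exists v : V, rnorm (u - (S v - z *: v)) <= d.

(** As [u] is nearly [(S - xi) v], the vector [p(S) u] is nearly [(p (X - xi))(S) v], small by the
    choice of the bump once [v] is known. The pair [rq] comes before [m]: the plateau is fixed
    before the degree. *)
Lemma exists_killing_bump xi (d : R) :
  cabs xi = 1 -> approx_range xi -> 0 < d ->
  exists rq : R * R, [/\ 0 < rq.1, 0 <= rq.2 < 1 &
  forall m : nat, exists p : {poly R[i]},
  [/\ (size p <= m.*2.+1)%N, anorm p <= 2, rnorm (pact S p u) <= d
    & forall z, cabs z = 1 -> cabs (z - xi) <= rq.1 ->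
      cabs (z ^+ m - p.[z]) <= m.*2.+1%:R * rq.2 ^+ m]].
Proof.
move=> xi1 uxi d0.
have [|v uv] := uxi (d / 4); first by rewrite divr_gt0.
have v0 := rnorm_ge0 v.
(* The term in [v] gets [d / 2] and the approximation error [2 * (d / 4)]; the [+ 1] covers
   [v = 0]. *)
have eps0 : 0 < d / (2 * (rnorm v + 1)) by rewrite divr_gt0// mulr_gt0//; lra.
have [r r0 [q q01 H]] := exists_bump eps0.
exists (r, q); split=> // m; have [p [sp p2 pe pw]] := H m xi xi1.
exists p; split=> //.
have -> : pact S p u =
    pact S p (u - (S v - xi *: v)) + pact S (p * ('X - xi%:P)) v.
  by rewrite pactM pactXsub -pactDr subrK.
rewrite (le_trans (rnormD _ _))//.
have h1 := rnorm_pact S_isom p (u - (S v - xi *: v)).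
have h2 := rnorm_pact S_isom (p * ('X - xi%:P)) v.
have h3 : anorm p * rnorm (u - (S v - xi *: v)) <= 2 * (d / 4).
  by rewrite ler_pM ?rnorm_ge0 ?sumr_ge0// => i _; exact: cabs_ge0.
have h4 : anorm (p * ('X - xi%:P)) * rnorm v <= d / 2.
  rewrite (le_trans (ler_wpM2r v0 pe))//.
  by rewrite mulrAC ler_pdivrMr; nra.
by lra.
Qed.

(** * Products of notch factors *)

Section Product.
Variables (m : nat) (P : nat -> {poly R[i]}).
Hypothesis size_P : forall j, (size (P j) <= m.*2.+1)%N.
Hypothesis anorm_P : forall j, anorm (P j) <= 2.

(** On the circle this is [z^(m n)] times the product of the factors [1 - z^(-m) P j], each nearly 0
    where [P j] is close to [z^m]. *)
Let H n := \prod_(j < n) ('X^m - P j).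

Lemma size_notch n : (size (H n) <= (m.*2 * n).+1)%N.
Proof.
elim: n => [|n IH]; first by rewrite /H big_ord0 size_poly1.
rewrite /H big_ord_recr /= (leq_trans (size_polyMleq _ _))//.
have s2 : (size ('X^m - P n)%R <= m.*2.+1)%N.
  rewrite (leq_trans (size_polyD _ _))// geq_max size_polyXn size_polyN size_P.
  by rewrite andbT ltnS -addnn leq_addl.
rewrite mulnS -/(H n).
by move: (size (H n)) (size ('X^m - P n)%R) IH s2 => i j; lia.
Qed.

Lemma rnorm_notch n v : rnorm (pact S (H n) v) <= 3 ^+ n * rnorm v.
Proof.
elim: n v => [|n IH] v; first by rewrite /H big_ord0 pact1 mul1r.
rewrite /H big_ord_recr /= pactM (le_trans (IH _))// exprSr -mulrA ler_wpM2l//.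
rewrite pactD pactN pactXn (le_trans (rnormD _ _))// rnormN rnorm_iter//.
have := rnorm_pact S_isom (P n) v.
have := ler_wpM2r (rnorm_ge0 v) (anorm_P n); lra.
Qed.

Lemma notch_le n z : cabs z = 1 -> cabs (H n).[z] <= 3 ^+ n.
Proof.
move=> z1; elim: n => [|n IH]; first by rewrite /H big_ord0 hornerC cabs1.
rewrite /H big_ord_recr /= hornerM cabsM exprSr ler_pM ?cabs_ge0//.
rewrite hornerD hornerN hornerXn (le_trans (cabsB _ _))// cabsX z1 expr1n.
have := cabs_horner (P n) z1; have := anorm_P n; lra.
Qed.

Lemma notch_small n j z d : cabs z = 1 -> (j < n)%N ->
  cabs (z ^+ m - (P j).[z]) <= d -> cabs (H n).[z] <= 3 ^+ n * d.
Proof.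
move=> z1 + zd; have d0 : 0 <= d := le_trans (cabs_ge0 _) zd.
elim: n => // n IH; rewrite ltnS leq_eqVlt => jn.
rewrite /H big_ord_recr /= hornerM cabsM hornerD hornerN hornerXn.
have [jnE|/IH{}IH] := predU1P jn.
  rewrite jnE in zd.
  rewrite exprSr -mulrA ler_pM ?cabs_ge0//; first exact: notch_le.
  by rewrite (le_trans zd)//; lra.
rewrite exprSr mulrAC ler_pM ?cabs_ge0//.
rewrite (le_trans (cabsB _ _))// cabsX z1 expr1n.
have := cabs_horner (P n) z1; have := anorm_P n; lra.
Qed.

(** Inserting the factors one at a time costs at most [3^j |P_j(S) u|] at step [j], and these costs
    form a geometric series. *)
Lemma notch_dist n (d : R) :
  (forall j, 3 ^+ j * rnorm (pact S (P j) u) <= d * 2^-1 ^+ j.+1) -> 0 <= d ->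
  rnorm (iter (m * n) S u - pact S (H n) u) <= d * (1 - 2^-1 ^+ n).
Proof.
move=> Pd d0; elim: n => [|n IH].
  by rewrite /H big_ord0 pact1 muln0 /= subrr rnorm0 expr0 subrr mulr0.
rewrite /H big_ord_recr /= -/(H n) pactM pactD pactN pactXn.
have -> : pact S (H n) (iter m S u - pact S (P n) u) =
    iter m S (pact S (H n) u) - pact S (H n) (pact S (P n) u).
  by rewrite pactBr pact_iter.
have -> : iter (m * n.+1) S u = iter m S (iter (m * n) S u).
  by rewrite -iterD mulnS.
have itB v w : iter m S v - iter m S w = iter m S (v - w).
  by rewrite -!pactXn pactBr.
rewrite opprB addrCA addrC itB (le_trans (rnormD _ _))// rnorm_iter//.
have := rnorm_notch n (pact S (P n) u); have := Pd n.
rewrite !exprS; lra.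
Qed.

End Product.
Lemma resolvedW C C' z : C <= C' -> resolved C z -> resolved C' z.
Proof.
by move=> CC' H d /H[w wC ?]; exists w => //; exact: le_trans CC'.
Qed.

(** Compactness of [[0, 2 pi]] as near covering: the same [n] bounds the indices of the arcs and the
    norms of the solutions, so around each angle one alternative persists for all large [n]. *)
Lemma circle_cover (e : nat -> R[i]) (r : nat -> R) :
  (forall j, 0 < r j) ->
  (forall xi, cabs xi = 1 -> (forall j, xi <> e j) ->
    exists2 d : R, 0 < d & exists C : R, forall z, cabs z = 1 ->
      cabs (z - xi) < d -> resolved C z) ->
  exists n, forall t, 0 <= t <= pi *+ 2 ->
    (exists2 j, (j < n)%N & cabs (expi t - e j) <= r j) \/
    resolved n%:R (expi t).
Proof.
move=> r0 reg.
pose P (n : nat) t := (exists2 j, (j < n)%N & cabs (expi t - e j) <= r j) \/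
    resolved n%:R (expi t).
have /compact_near_coveringP/(_ nat \oo P _) := @segment_compact R 0 (pi *+ 2).
case=> [t _|N _ PN]; last first.
  by exists N => t t01; apply: (PN N) => //=; rewrite in_itv.
have cont d : 0 < d -> \forall t' \near t, cabs (expi t' - expi t) < d.
  move=> d0; apply/nbhs_ballP; exists (d / 2) => /=; first by rewrite divr_gt0.
  move=> t'; rewrite /ball/= => tt'.
  rewrite (le_lt_trans (expi_lipschitz _ _))// distrC mulrC -ltr_pdivlMr//.
have [[j tj]|/forallNP nj] := pselect (exists j, expi t = e j).
  exists ([set t' | cabs (expi t' - expi t) < r j], [set n | (j < n)%N]).
    by split; [exact: cont|exists j.+1].
  move=> [t' n] /= [t'r jn]; left; exists j => //.
  by rewrite -tj ltW.
have [d d0 [C HC]] := reg _ (cabs_expi t) nj.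
pose N := (Num.truncn C).+1.
exists ([set t' | cabs (expi t' - expi t) < d], [set n | (N <= n)%N]).
  by split; [exact: cont|exists N].
move=> [t' n] /= [t'd Nn]; right.
apply: resolvedW (HC _ (cabs_expi t') t'd).
by rewrite (le_trans (ltW (truncnS_gt _)))// ler_nat.
Qed.

Theorem isometry_orbit0 (e : nat -> R[i]) :
  (forall j, cabs (e j) = 1) -> (forall j, approx_range (e j)) ->
  (forall xi, cabs xi = 1 -> (forall j, xi <> e j) ->
    exists2 d : R, 0 < d & exists C : R, forall z, cabs z = 1 ->
      cabs (z - xi) < d -> resolved C z) ->
  u = 0.
Proof.
move=> e1 eu reg; apply: rnorm_eq0; apply/eqP; rewrite eq_le rnorm_ge0 andbT.
apply/ler_addgt0Pl => d2 d20; rewrite addr0.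
pose d := d2 / 2; have d0 : 0 < d by rewrite divr_gt0.
(* Dividing by [6 ^+ j] leaves [2^-j] after the norm bound [3 ^+ j] of the preceding notches. *)
have dj j : 0 < d / 2 / 6 ^+ j by rewrite !divr_gt0// exprn_gt0.
have /choice[rq rqP] := fun j => exists_killing_bump (e1 j) (eu j) (dj j).
have [|n0 cover0] := circle_cover (r := fun j => (rq j).1) _ reg.
  by move=> j; have [] := rqP j.
(* [n] is made positive so that [K = 2 m n] is at least [m]. *)
pose n := n0.+1.
have cover t : 0 <= t <= pi *+ 2 ->
    (exists2 j, (j < n)%N & cabs (expi t - e j) <= (rq j).1) \/
    resolved n%:R (expi t).
  move=> /cover0[[j jn tj]|H]; [by left; exists j => //; exact: ltnW|right].
  by apply: resolvedW H; rewrite ler_nat.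
(* [D j / (m + 1)] will bound the notch product times the density near [e j], and [G] adds the bound
   for resolved points. The plateaus are chosen first, then [n], then [m]. *)
pose D j := 3 ^+ n * (2 * (4 * n%:R + 2)) * rnorm u * (3 / (1 - (rq j).2)) ^+ 3.
have D0 j : 0 <= D j.
  have [_ /andP[_ q1] _] := rqP j; have nn : 0 <= n%:R :> R by [].
  by rewrite !mulr_ge0 ?rnorm_ge0 ?exprn_ge0 ?invr_ge0//; lra.
pose G := \sum_(j < n) D j + 3 ^+ n * (4 * n%:R + 1).
pose m := Num.truncn (G / d).
have Gm : G / m.+1%:R <= d.
  by rewrite ler_pdivrMr ?ltr0n// mulrC -ler_pdivrMr// ltW// truncnS_gt.
have /choice[P PP] : forall j, exists p : {poly R[i]},
  [/\ (size p <= m.*2.+1)%N, anorm p <= 2, rnorm (pact S p u) <= d / 2 / 6 ^+ j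
    & forall z, cabs z = 1 -> cabs (z - e j) <= (rq j).1 ->
      cabs (z ^+ m - p.[z]) <= m.*2.+1%:R * (rq j).2 ^+ m].
  by move=> j; have [_ _ /(_ m)] := rqP j.
have sP j : (size (P j) <= m.*2.+1)%N by have [] := PP j.
have aP j : anorm (P j) <= 2 by have [] := PP j.
pose H := \prod_(j < n) ('X^m - P j).
have uH : rnorm (iter (m * n) S u - pact S H u) <= d.
  have /(_ _ (ltW d0))/le_trans := @notch_dist m P aP n d.
  apply; last by rewrite ler_piMr ?(ltW d0)// gerBl exprn_ge0.
  move=> j; have [_ _ Pu _] := PP j.
  rewrite (le_trans (ler_wpM2l _ Pu)) ?exprn_ge0//.
  rewrite (_ : 6 = 3 * 2) ?exprMn; last by ring.
  rewrite le_eqVlt; apply/orP; left; apply/eqP; rewrite exprS exprVn.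
  by field; rewrite !expf_neq0.
have Hu : rnorm (pact S H u) <= d.
  apply: (@rnorm_pact_le _ _ S S_isom (m.*2 * n)) => [|t tlim].
    exact: size_notch.
  set K := (m.*2 * n)%N; set z := expi t.
  have z1 : cabs z = 1 by exact: cabs_expi.
  have m0 : 0 < m.+1%:R :> R by rewrite ltr0n.
  have [[j jn tj]|res] := cover t tlim.
    have [_ _ _ /(_ z z1 tj) Pz] := PP j.
    have Hz := notch_small (n := n) aP z1 jn Pz.
    have Vz := rnorm_density S_isom K u z1.
    rewrite (le_trans (ler_pM (cabs_ge0 _) (rnorm_ge0 _) Hz Vz))//.
    have [_ q01 _] := rqP j.
    have qm := sqr_geometric_le m q01.
    apply: (@le_trans _ _ (D j / m.+1%:R)).
      apply: ler_product_chain qm; rewrite ?exprn_ge0 ?rnorm_ge0//.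
        by case/andP: q01.
      have h1 : m.*2.+1%:R <= 2 * m.+1%:R :> R.
        by rewrite -natrM ler_nat mul2n doubleS ltnS leqnSn.
      have h2 : K.*2.+2%:R <= (4 * n%:R + 2) * m.+1%:R :> R.
        by rewrite -natrM -natrD -natrM ler_nat notch_degree_le.
      by rewrite (le_trans (ler_pM _ _ h1 h2))// expr2 mulrACA.
    rewrite (le_trans _ Gm)// ler_wpM2r ?invr_ge0 ?(ltW m0)//.
    by rewrite /G (bigD1 (Ordinal jn))//= -addrA lerDl addr_ge0 ?sumr_ge0.
  have K0 : 0 < K.+1%:R :> R by rewrite ltr0n.
  (* With this error the trivial term [(2K + 2) e] equals [1 / (K + 1)]. *)
  have [|w wn uw] := res ((K.*2.+2%:R * K.+1%:R)^-1).
    by rewrite invr_gt0 mulr_gt0 ?ltr0n.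
  have Vz := rnorm_density_resolved S_isom K z1 uw.
  rewrite (le_trans (ler_pM (cabs_ge0 _) (rnorm_ge0 _) (notch_le m aP n z1) Vz))//.
  have mK : K.+1%:R^-1 <= m.+1%:R^-1 :> R.
    by rewrite lef_pV2 ?posrE// ler_nat ltnS /K -addnn mulnDl mulnS -!addnA leq_addr.
  apply: (@le_trans _ _ (3 ^+ n * (4 * n%:R + 1) / m.+1%:R)); last first.
    rewrite (le_trans _ Gm)// ler_wpM2r ?invr_ge0 ?(ltW m0)//.
    by rewrite /G lerDr sumr_ge0.
  rewrite -[leRHS]mulrA ler_wpM2l ?exprn_ge0// invfM mulrA mulfV ?pnatr_eq0// mul1r.
  rewrite [leRHS]mulrDl mul1r lerD// ler_pM ?invr_ge0 ?mulr_ge0 ?rnorm_ge0 ?(ltW K0)//.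
  by rewrite ler_wpM2l.
(* [u] has the norm of [S^(m n) u], which is within [d] of [H(S) u], itself of norm at most [d]. *)
rewrite -(rnorm_iter S_isom (m * n)) -(subrK (pact S H u) (iter _ _ _)).
rewrite (le_trans (rnormD _ _))// (le_trans (lerD uH Hu))//.
by rewrite /d; lra.
Qed.

End CountableSpectrum.

(** * Approximate resolvents near a regular point *)

Section NeumannSeries.
Context {R : realType} {V : normedModType R[i]}.
Variable S : {linear V -> V}.
Variables (g : nat -> V) (xi : R[i]) (M C : R).
Hypothesis gS : forall k, xi *: g k.+1 - S (g k.+1) = g k.
Hypothesis g_le : forall k, rnorm (g k) <= M ^+ k * C.
Hypothesis M0 : 0 <= M.
Hypothesis C0 : 0 <= C.

Let M1_gt0 : 0 < 2 * (M + 1).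
Proof. by rewrite mulr_gt0// ltr_wpDl. Qed.

Let A z v : V := z *: v - S v.

Let A_sum z n (c : nat -> R[i]) (F : nat -> V) :
  A z (\sum_(l < n) c l *: F l) = \sum_(l < n) c l *: A z (F l).
Proof.
rewrite /A (linear_sum S) scaler_sumr -sumrB; apply: eq_bigr => l _.
by rewrite [S _]linearZ/= scalerBr !scalerA mulrC.
Qed.

Let A_lin z c v w : A z (v - c *: w) = A z v - c *: A z w.
Proof.
have -> : A z (v - c *: w) = z *: v - z *: (c *: w) - (S v - c *: S w).
  have SB x y : S (x - y) = S x - S y by rewrite linearB.
  have SZ x : S (c *: x) = c *: S x by rewrite linearZ.
  by rewrite /A scalerBr SB SZ.
rewrite /A scalerBr !scalerA (mulrC c).
by rewrite !opprB addrACA [RHS]addrACA; congr (_ + _); exact: addrC.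
Qed.

(** Truncated Neumann series for [(z - S)^-1 (g k)], where [g k] plays the role of the [k]-th power
    of a resolvent at [xi] applied to [g 0]. *)
Let W z n k : V := \sum_(l < n) (xi - z) ^+ l *: g (k + l).+1.

Let AW z n k : A z (W z n k) = g k - (xi - z) ^+ n *: g (k + n).
Proof.
rewrite (A_sum z n (fun l => (xi - z) ^+ l) (fun l => g (k + l).+1)).
have step l : (xi - z) ^+ l *: A z (g (k + l).+1) =
    (xi - z) ^+ l *: g (k + l) - (xi - z) ^+ l.+1 *: g (k + l.+1).
  have -> : A z (g (k + l).+1) = g (k + l) - (xi - z) *: g (k + l).+1.
    by rewrite /A -(gS (k + l)) scalerBl opprB [RHS]addrC addrA subrK.
  by rewrite scalerBr scalerA -exprSr addnS.
elim: n => [|n IH]; first by rewrite big_ord0 expr0 scale1r addn0 subrr.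
by rewrite big_ord_recr /= IH step addrA subrK.
Qed.

Let ratio_le z : cabs (z - xi) <= (2 * (M + 1))^-1 -> cabs (z - xi) * M <= 2^-1.
Proof.
move=> zxi; rewrite (le_trans (ler_wpM2r M0 zxi))// [leLHS]mulrC ler_pdivrMr//.
by rewrite mulKf// lerDl.
Qed.

Let term_le z k l : cabs (z - xi) <= (2 * (M + 1))^-1 ->
  rnorm ((xi - z) ^+ l *: g (k + l)) <= M ^+ k * C * 2^-1 ^+ l.
Proof.
move=> zxi; rewrite rnormZ -/(cabs _) cabsX (cabsC xi).
have c0 := cabs_ge0 (z - xi).
rewrite (le_trans (ler_wpM2l _ (g_le _))) ?exprn_ge0// exprD.
rewrite [leLHS](_ : _ = M ^+ k * C * (cabs (z - xi) * M) ^+ l); last first.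
  by rewrite exprMn; ring.
rewrite ler_wpM2l ?mulr_ge0 ?exprn_ge0// lerXn2r ?nnegrE ?mulr_ge0//.
exact: ratio_le.
Qed.

Let half_sum n : \sum_(l < n) 2^-1 ^+ l <= 2 :> R.
Proof.
suff : \sum_(l < n) 2^-1 ^+ l = 2 - 2 * 2^-1 ^+ n :> R.
  by move=> ->; rewrite gerBl mulr_ge0// exprn_ge0.
elim: n => [|n IH]; first by rewrite big_ord0 expr0 mulr1 subrr.
by rewrite big_ord_recr /= IH exprS; field.
Qed.

Let W_le z n k : cabs (z - xi) <= (2 * (M + 1))^-1 ->
  rnorm (W z n k) <= M ^+ k.+1 * C * 2.
Proof.
move=> zxi; rewrite (le_trans (rnorm_sum _ _ _))//.
rewrite (le_trans (ler_sum _ (fun (l : 'I_n) _ => term_le k.+1 l zxi)))//.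
by rewrite -mulr_sumr (ler_wpM2l _ (half_sum n)) ?mulr_ge0 ?exprn_ge0.
Qed.

Lemma resolved_near : exists2 d : R, 0 < d & exists C' : R,
  forall z, cabs z = 1 -> cabs (z - xi) < d -> resolved S (g 0) C' z.
Proof.
(* This radius makes [|z - xi| M] at most one half; the [+ 1] covers [M = 0]. *)
exists (2 * (M + 1))^-1; first by rewrite invr_gt0.
exists (M ^+ 2 * C * 4) => z _ /ltW zxi d d0.
pose n := Num.truncn (4 * C / d).
have nd : 4 * C * 2^-1 ^+ n <= d.
  rewrite (@le_trans _ _ (4 * C / n.+1%:R))//.
    rewrite ler_wpM2l ?mulr_ge0// exprVn lef_pV2 ?posrE ?exprn_gt0 ?ltr0n//.
    by rewrite -natrX ler_nat ltn_expl.
  by rewrite ler_pdivrMr ?ltr0n// [leRHS]mulrC -ler_pdivrMr// ltW// truncnS_gt.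
(* Replacing each term [g l.+1] of [W z n 0] by its own truncated series inverts [z - S] a second
   time. *)
exists (\sum_(l < n) (xi - z) ^+ l *: W z n l.+1).
  rewrite (le_trans (rnorm_sum _ _ _))//.
  apply: (@le_trans _ _ (\sum_(l < n) M ^+ 2 * C * 2 * 2^-1 ^+ l)).
    apply: ler_sum => l _; rewrite rnormZ -/(cabs _) cabsX (cabsC xi).
    rewrite (le_trans (ler_wpM2l _ (W_le _ _ zxi))) ?exprn_ge0 ?cabs_ge0//.
    rewrite 2!exprS [leLHS](_ : _ = M ^+ 2 * C * 2 * (cabs (z - xi) * M) ^+ l).
      rewrite ler_wpM2l ?mulr_ge0 ?exprn_ge0// lerXn2r ?nnegrE ?mulr_ge0 ?cabs_ge0//.
      exact: ratio_le.
    by rewrite exprMn; ring.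
  rewrite -mulr_sumr (le_trans (ler_wpM2l _ (half_sum n))) ?mulr_ge0 ?exprn_ge0//.
  by rewrite -[leLHS]mulrA -natrM.
rewrite -!/(A z _) (A_sum z n (fun l => (xi - z) ^+ l) (fun l => W z n l.+1)).
have -> : \sum_(l < n) (xi - z) ^+ l *: A z (W z n l.+1) =
    W z n 0 - (xi - z) ^+ n *: W z n n.
  rewrite /W scaler_sumr -sumrB; apply: eq_bigr => l _.
  rewrite AW scalerBr !scalerA mulrC add0n.
  by congr (_ - _ *: g _); rewrite addSn addnC.
rewrite A_lin !AW add0n scalerBr scalerA -exprD.
have e1 := term_le 0 n zxi; have e2 := term_le 0 (n + n) zxi.
rewrite !add0n expr0 mul1r in e1 e2.
set v1 := _ *: g n in e1 *; set v2 := _ *: g (n + n) in e2 *.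
(* The two truncations leave three remainders, each at most [C / 2^n]. *)
rewrite (_ : _ - _ = v1 + (v1 - v2)); last first.
  by rewrite opprB (opprB (g 0)) addrC -addrA subrK addrC.
have n0 : 0 <= C * 2^-1 ^+ n by rewrite mulr_ge0 ?exprn_ge0.
have n1 : C * 2^-1 ^+ (n + n) <= C * 2^-1 ^+ n.
  by rewrite exprD mulrA ler_piMr// exprn_ile1// invf_le1// ler1n.
rewrite (le_trans (rnormD _ _))// (le_trans (lerD e1 (rnormD _ _)))// rnormN.
by rewrite (le_trans _ nd)//; lra.
Qed.

End NeumannSeries.

(** * The shift on the quotient space *)

Section QuotientShift.
Context {R : realType} {X : completeNormedModType R[i]}.
Implicit Types (x : linf X) (u v : linf_quot X).

Lemma rnorm_class_le x : rnorm (c0_class x) <= rnorm x.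
Proof. exact: quot_rnorm_le. Qed.

Lemma quot_shift_linear : linear (@quot_shift R X).
Proof.
move=> a u v; rewrite -(class_repr u) -(class_repr v) -classZ -classD !quot_shiftE.
by rewrite -classZ -classD; congr c0_class; exact: val_inj.
Qed.

HB.instance Definition _ := GRing.isLinear.Build R[i] (linf_quot X) (linf_quot X)
  *:%R (@quot_shift R X) quot_shift_linear.

Lemma quot_shiftB u v : quot_shift (u - v) = quot_shift u - quot_shift v.
Proof. exact: raddfB. Qed.

Lemma linf_unshift_bounded x :
  (fun n => if n is k.+1 then x k else 0) \in @bounded_seq R X.
Proof.
have [M xM] := linf_bounded x; apply/bounded_seqP; exists M => -[|n] //.
by rewrite rnorm0 (le_trans (rnorm_ge0 _) (xM 0%N)).
Qed.

Definition linf_unshift x : linf X := Linf (linf_unshift_bounded x).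

(** A representative of the shifted class, preceded by a 0, represents [u] with no larger norm. *)
Lemma quot_shift_isometry u : rnorm (quot_shift u) = rnorm u.
Proof.
apply/eqP; rewrite eq_le; apply/andP; split.
  apply: le_quot_rnorm => x <-; rewrite quot_shiftE (le_trans (rnorm_class_le _))//.
  by apply: linf_rnorm_le => n; exact: (linf_rnorm_ub x n.+1).
apply: le_quot_rnorm => x xu.
have -> : u = c0_class (linf_unshift x).
  rewrite -(class_repr u); apply/classP/c0P => e e0.
  have /classP/c0P/(_ _ e0)[N HN] : c0_class (linf_shift (repr u)) = c0_class x.
    by rewrite xu.
  by exists N.+1 => -[|n] //= Nn; exact: HN.
rewrite (le_trans (rnorm_class_le _))//; apply: linf_rnorm_le => -[|n] /=.
  by rewrite rnorm0 linf_rnorm_ge0.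
exact: linf_rnorm_ub.
Qed.

Lemma quot_shift_lower_bound l u :
  (cabs l - 1) * rnorm u <= rnorm (l *: u - quot_shift u).
Proof.
rewrite mulrBl mul1r -[rnorm u in X in _ - X]quot_shift_isometry lerBlDr.
by rewrite -rnormZ -[X in rnorm X <= _](subrK (quot_shift u)) rnormD.
Qed.

Lemma geometric_sum_le (q : R) n : 0 <= q < 1 -> \sum_(k < n) q ^+ k <= (1 - q)^-1.
Proof.
move=> /andP[q0 q1]; have d0 : 0 < 1 - q by rewrite subr_gt0.
rewrite -[leRHS]mul1r ler_pdivlMr// mulrC.
rewrite -[1 - q]opprB mulNr -subrX1 opprB gerBl exprn_ge0//.
Qed.

(* Truncating the Neumann series of the resolvent at a rank that grows with the
   index only changes it by a sequence in c0. *)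
Lemma quot_shift_resolvent_onto l u : 1 < cabs l ->
  exists v, l *: v - quot_shift v = u.
Proof.
move=> l1; have l0 : l != 0 by rewrite -cabs_eq0 gt_eqF// (lt_trans ltr01).
pose q := (cabs l)^-1.
have q01 : 0 <= q < 1 by rewrite invr_ge0 cabs_ge0 invf_lt1// (lt_trans ltr01).
have /andP[q0 q1] := q01.
pose x := repr u; have [M xM] := linf_bounded x.
have M0 : 0 <= M := le_trans (rnorm_ge0 _) (xM 0%N).
have term j k : rnorm (l^-1 ^+ j *: x k) <= M * q ^+ j.
  by rewrite rnormZ -/(cabs _) cabsX cabsV mulrC ler_pM ?exprn_ge0 ?rnorm_ge0.
pose z n : X := \sum_(k < n) l^-1 ^+ k.+1 *: x (n + k)%N.
have zb : z \in @bounded_seq R X.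
  apply/bounded_seqP; exists (M * (1 - q)^-1) => n.
  rewrite (le_trans (rnorm_sum _ _ _))//.
  rewrite (le_trans (ler_sum _ (fun (k : 'I_n) _ => term k.+1 (n + k)%N)))//.
  rewrite -mulr_sumr ler_wpM2l// (le_trans _ (geometric_sum_le n q01))//.
  by apply: ler_sum => k _; rewrite exprS ler_piMl ?exprn_ge0// ltW.
exists (c0_class (Linf zb)); rewrite -(class_repr u) quot_shiftE -classZ -classB.
apply/classP/c0P => e e0.
(* The truncation rank grows by one with the index, so telescoping leaves only the two terms of
   highest rank. *)
have zE n : l *: z n - z n.+1 - x n =
    - (l^-1 ^+ n *: x (n + n)%N + l^-1 ^+ n.+1 *: x (n + n.+1)%N).
  pose G j := l^-1 ^+ j *: x (n + j)%N.
  have -> : l *: z n = \sum_(k < n) G k.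
    rewrite scaler_sumr; apply: eq_bigr => k _.
    by rewrite scalerA exprS mulrA mulfV// mul1r.
  have -> : z n.+1 = \sum_(k < n.+1) G k.+1.
    by apply: eq_bigr => k _; rewrite /G addSnnS.
  have GE : \sum_(k < n.+1) G k.+1 + x n = \sum_(k < n) G k + (G n + G n.+1).
    rewrite addrA -2!(big_ord_recr _ (fun k => G (nat_of_ord k))) big_ord_recl /=.
    by rewrite addrC /G expr0 scale1r addn0.
  by rewrite -addrA -opprD GE opprD addrA subrr add0r.
have d0 : 0 < 1 - q by rewrite subr_gt0.
pose T := (3 / (1 - q)) ^+ 3.
have T0 : 0 <= T by rewrite exprn_ge0// divr_ge0// ltW.
exists (Num.truncn (T * (2 * M) / e)) => n Nn.
rewrite -[X in rnorm X]/(l *: z n - z n.+1 - x n) zE rnormN.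
have n0 : 0 < n.+1%:R :> R by rewrite ltr0n.
have qn : q ^+ n <= T / n.+1%:R.
  rewrite (le_trans _ (sqr_geometric_le n q01))// ler_peMl ?exprn_ge0//.
  by rewrite exprn_ege1// ler1n.
have qS : M * q ^+ n.+1 <= M * q ^+ n.
  by rewrite ler_wpM2l// exprS ler_piMl ?exprn_ge0// ltW.
rewrite (le_lt_trans (rnormD _ _))// (le_lt_trans (lerD (term _ _) (term _ _)))//.
apply: (@le_lt_trans _ _ (2 * M * (T / n.+1%:R))).
  have := ler_wpM2l M0 qn; move: (M * q ^+ n) (M * q ^+ n.+1) (T / _) qS => a b t.
  by lra.
rewrite mulrA ltr_pdivrMr// [ltRHS]mulrC -ltr_pdivrMr// (mulrC _ T).
by rewrite (lt_le_trans (truncnS_gt _))// ler_nat.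
Qed.

(** Surjectivity and the lower bound give an inverse of norm at most [(cabs l - 1)^-1]; outside the
    closed disc [resolvent] is thus a true inverse and not its default. *)
Lemma resolvent_set_quot_shift l : 1 < cabs l -> resolvent_set (@quot_shift R X) l.
Proof.
move=> l1.
have /choice[T TE] : forall u, exists v, l *: v - quot_shift v = u.
  by move=> u; exact: quot_shift_resolvent_onto.
have d0 : 0 < cabs l - 1 by rewrite subr_gt0.
have inj u v : l *: u - quot_shift u = l *: v - quot_shift v -> u = v.
  move=> uv; apply/eqP; rewrite -subr_eq0; apply/eqP/rnorm_eq0/eqP.
  rewrite eq_le rnorm_ge0 andbT -(ler_pM2l d0) mulr0.
  rewrite (le_trans (quot_shift_lower_bound _ _))//.
  have -> : l *: (u - v) - quot_shift (u - v) =
      (l *: u - quot_shift u) - (l *: v - quot_shift v).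
    rewrite quot_shiftB scalerBr !opprB addrACA [RHS]addrACA.
    by congr (_ + _); exact: addrC.
  by rewrite uv subrr rnorm0.
have Tlin : linear T.
  move=> a u v; apply: inj; rewrite TE quot_shift_linear scalerDr !scalerA.
  rewrite (mulrC l) -scalerA opprD addrACA -scalerBr !TE.
  by [].
have Tle v : rnorm (T v) <= (cabs l - 1)^-1 * rnorm v.
  by rewrite ler_pdivlMl// -{2}(TE v) quot_shift_lower_bound.
exists T; split; [split=> //| |].
- exists ((cabs l - 1)^-1)%:C; split.
    by apply/complex_realP; exists (cabs l - 1)^-1.
  move=> M ltM v; rewrite (le_trans _ (ler_wpM2r (normr_ge0 v) (ltW ltM)))//.
  by rewrite !rnormE -rmorphM lecR.
- by move=> v; apply: inj; rewrite TE.
- by move=> v; rewrite TE.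
Qed.

End QuotientShift.

(** * The class of the orbit under the shift *)

Section Orbit.
Context {R : realType} {X : completeNormedModType R[i]}.
Notation shift := (@quot_shift R X : {linear linf_quot X -> linf_quot X}).

Lemma bounded_operator_rnorm (T : X -> X) : bounded_operator T ->
  exists2 M : R, 0 <= M & forall v, rnorm (T v) <= M * rnorm v.
Proof.
move=> [_ /pinfty_ex_gt0[M M0 TM]].
have ME : M = (complex.Re M)%:C by rewrite RRe_real// gtr0_real.
exists (complex.Re M); first by rewrite -ler0c -ME ltW.
by move=> v; have := TM v; rewrite ME !rnormE -rmorphM lecR.
Qed.

(** With [r = R(l, S) u], the identity [u - (xi - S) r = (l - xi) r] turns the limit into an
    approximation of [u]. *)
Lemma approx_range_downto (u : linf_quot X) (xi : R[i]) : cabs xi = 1 ->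
  (l - xi) *: resolvent l shift u @[l --> downto xi] --> (0 : linf_quot X) ->
  approx_range shift u xi.
Proof.
move=> xi1 /cvgr0Pnorm_lt lim d d0.
have dC : 0 < d%:C :> R[i] by rewrite ltcR.
have := lim _ dC; rewrite /downto -/(cabs _) xi1 cabsE xi1 divr1 => near_d.
have [s [s1 sd]] : exists s : R, 1 < s /\
    `|(s%:C * xi - xi) *: resolvent (s%:C * xi) shift u| < d%:C.
  near (1 : R)^'+ => s; exists s; split; first by near: s; exact: nbhs_right_gt.
  by near: s; exact: near_d.
set l := s%:C * xi in sd *.
have l1 : 1 < cabs l.
  by rewrite cabsM xi1 mulr1 cabsR ger0_norm// ltW// (lt_trans ltr01).
have [_ _ rK] := resolventP (resolvent_set_quot_shift (X := X) l1).
have ru := rK u; move: (resolvent l _ u) sd ru => r sd ru.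
exists (- r); rewrite rnormE ltcR in sd; rewrite (le_trans _ (ltW sd))//.
rewrite (_ : u - _ = (l - xi) *: r)//.
have -> : shift (- r) = - shift r by rewrite raddfN.
by rewrite -ru scalerN opprK scalerBl opprD opprK addrA subrK.
Unshelve. all: by end_near.
Qed.

(** With [T] the resolvent of [B] at [xi], the classes of the sequences [T^k x(n)] satisfy the
    Neumann recursion: applying [T^(k+1)] to the recurrence leaves the error [T^(k+1) y(n)], which
    tends to 0. *)
Lemma resolved_off_spectrum (B : X -> X) (x : linf X) (y : nat -> X) (xi : R[i]) :
  bounded_operator B -> y @ \oo --> (0 : X) ->
  (forall n : nat, x n.+1 = B (x n) + y n) -> ~ spectrum B xi ->
  exists2 d : R, 0 < d & exists C : R, forall z, cabs z = 1 ->
    cabs (z - xi) < d -> resolved shift (c0_class x) C z.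
Proof.
move=> [Blin _] /cvg0_rnorm y0 hx /contrapT[T [Tbd TK _]].
have [Tlin _] := Tbd; have [M M0 TM] := bounded_operator_rnorm Tbd.
pose gx k n : X := iter k T (x n).
have itT k v : rnorm (iter k T v) <= M ^+ k * rnorm v.
  elim: k => [|k IH] /=; first by rewrite mul1r.
  by rewrite (le_trans (TM _))// exprS -mulrA ler_wpM2l.
have gx_le k n : rnorm (gx k n) <= M ^+ k * rnorm x.
  rewrite (le_trans (itT _ _))// ler_wpM2l ?exprn_ge0//.
  exact: (linf_rnorm_ub x n).
have gb k : gx k \in @bounded_seq R X.
  by apply/bounded_seqP; exists (M ^+ k * rnorm x).
pose g k : linf_quot X := c0_class (Linf (gb k)).
have -> : c0_class x = g 0 by congr c0_class; exact: val_inj.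
have := @resolved_near R _ shift g xi M (rnorm x); apply => // [k|k|]; last first.
- exact: rnorm_ge0.
- rewrite (le_trans (rnorm_class_le _))//.
  by apply: linf_rnorm_le => n; exact: gx_le.
rewrite /= /g quot_shiftE -classZ -classB; apply/classP/c0P => e e0.
have [|N HN] := y0 (e / (M ^+ k.+1 + 1)).
  by rewrite divr_gt0// ltr_wpDl// exprn_ge0.
exists N => n /HN yn.
have T0 : T 0 = 0 by have := Tlin (-1) 0 0; rewrite scaler0 addr0 scaleN1r addNr.
have TB v w : T (v - w) = T v - T w.
  by rewrite -scaleN1r addrC Tlin scaleN1r addrC.
have TD v w : T (v + w) = T v + T w by rewrite -[v]scale1r Tlin !scale1r.
have TZ a v : T (a *: v) = a *: T v by rewrite -[a *: v]addr0 Tlin T0 addr0.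
have itB j v w : iter j T (v - w) = iter j T v - iter j T w.
  by elim: j => //= j ->.
have itZ j a v : iter j T (a *: v) = a *: iter j T v.
  by elim: j => //= j ->.
rewrite (_ : (_ - _ : linf X) n = - iter k.+1 T (y n)); last first.
  have -> : (xi *: Linf (gb k.+1) - linf_shift (Linf (gb k.+1)) - Linf (gb k)) n =
      xi *: gx k.+1 n - gx k.+1 n.+1 - gx k n by [].
  have E : T (x n.+1) = xi *: T (x n) - (x n - T (y n)).
    have := TK (x n); rewrite TB TZ => TKn.
    rewrite hx TD (_ : T (B (x n)) = xi *: T (x n) - x n).
      by rewrite opprB addrA addrAC.
    by rewrite -[X in _ - X]TKn opprB addrC subrK.
  rewrite /gx !iterSr E !itB itZ opprB addrCA subrr addr0 addrAC subrr add0r.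
  by [].
rewrite rnormN (le_lt_trans (itT _ _))//.
move: yn; rewrite ltr_pdivlMr ?ltr_wpDl ?exprn_ge0//; apply: le_lt_trans.
by rewrite mulrC ler_wpM2l ?rnorm_ge0// lerDl.
Qed.

End Orbit.

Theorem theorem2p10 (R : realType) (X : completeNormedModType R[i])
    (y : nat -> X) (hy : y @ \oo --> (0 : X))
    (B : X -> X) (hB : bounded_operator B)
    (hBcount : countable (spectrum B `&` unit_circle))
    (x : linf X) (hx : forall n : nat, x n.+1 = B (x n) + y n)
    (hlim : forall xi0 : R[i], (spectrum B `&` unit_circle) xi0 ->
      (lambda - xi0) *: resolvent lambda quot_shift (c0_class x)
        @[lambda --> downto xi0] --> (0 : linf_quot X)) :
  (x : nat -> X) @ \oo --> (0 : X).
Proof.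
pose S : {linear linf_quot X -> linf_quot X} := @quot_shift R X.
have reg (xi : R[i]) : cabs xi = 1 -> ~ (spectrum B `&` unit_circle) xi ->
    exists2 d : R, 0 < d & exists C : R, forall z, cabs z = 1 ->
      cabs (z - xi) < d -> resolved S (c0_class x) C z.
  move=> xi1 nxi; apply: (resolved_off_spectrum hB hy hx) => sxi.
  by apply: nxi; split=> //; exact/unit_circleE.
(* Proved on the whole circle, since the enumeration [e] below may take a value outside the
   spectrum. *)
have range (xi : R[i]) : cabs xi = 1 -> approx_range S (c0_class x) xi.
  move=> xi1; have [/hlim|/(reg _ xi1)[d d0 [C /(_ xi xi1)]]] :=
    pselect ((spectrum B `&` unit_circle) xi); first exact: approx_range_downto.
  rewrite subrr cabs0 => /(_ d0) res e e0; have [w _ wu] := res e e0.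
  exists (- (xi *: w - S w)); rewrite (le_trans _ wu)//.
  by rewrite raddfN scalerN opprK [X in _ - X]addrC.
have /countable_injP[f finj] := hBcount.
(* The injection [f] is inverted into a sequence through all spectral points of the circle; an index
   that [f] does not attain receives the point 1. *)
have /choice[e eP] : forall j, exists xi : R[i], cabs xi = 1 /\
    forall z, (spectrum B `&` unit_circle) z -> f z = j -> z = xi.
  move=> j; have [[z [Bz fz]]|nz] :=
    pselect (exists z, (spectrum B `&` unit_circle) z /\ f z = j).
    exists z; split; first by case: Bz => _ /unit_circleE.
    by move=> z' Bz' fz'; apply: finj; rewrite ?inE// fz'.
  by exists 1; split; [exact: cabs1|move=> z Bz fz; case: nz; exists z].
have x0 : c0_class x = 0.
  apply: (@isometry_orbit0 _ _ S (@quot_shift_isometry R X) _ e).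
  - by move=> j; case: (eP j).
  - by move=> j; apply: range; case: (eP j).
  move=> xi xi1 xie; apply: reg => // Bxi.
  by apply: (xie (f xi)); case: (eP (f xi)) => _; exact.
have /classP : c0_class x = c0_class 0 by rewrite class0.
by rewrite subr0 => /asboolP.
Qed.
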